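(* Let $\mathcal{A}=\{a_1,\ldots,a_n\}\subset\mathbb{Z}^d$ be a configuration of $n$ distinct vectors of maximal rank $d$ such that there is $\omega\in\mathbb{Q}^d$ with $\omega^Ta_i=1$ for all $i$, and let $r\ge1$. Let $\Delta$ be a full regular triangulation of $\mathcal{A}$ which has at least one $r$-partitionable set. Then $X_{\mathcal{A}}^{\{r\}}$ has the expected dimension $\min(rd-1,\,n-1)$, and the degree of $X_{\mathcal{A}}^{\{r\}}$ is bounded below by the number of $r$-partitionable sets in $\Delta$.
   Context: $\mathbb{K}$ is a field. The toric ideal $I_{\mathcal{A}}\subset\mathbb{K}[\mathbf{x}]=\mathbb{K}[x_1,\ldots,x_n]$ is the kernel of $\mathbb{K}[x_1,\ldots,x_n]\to\mathbb{K}[t_1^{\pm1},\ldots,t_d^{\pm1}]$, $x_j\mapsto\prod_{i=1}^d t_i^{a_{ij}}$, where $a_j=(a_{1j},\ldots,a_{dj})$; $X_{\mathcal{A}}\subset\mathbb{P}^{n-1}$ is the projective toric variety defined by $I_{\mathcal{A}}$ (of dimension $d-1$). Secants: for an ideal $I\subset\mathbb{K}[\mathbf{x}]$ and $r\ge1$, with new variables $\mathbf{y}_j=(y_{j1},\ldots,y_{jn})$, $j=1,\ldots,r$, and $I(\mathbf{y}_j)$ the image of $I$ under $\mathbf{x}\mapsto\mathbf{y}_j$, set $$I^{\{r\}}=\Bigl(I(\mathbf{y}_1)+\cdots+I(\mathbf{y}_r)+\langle y_{1i}+\cdots+y_{ri}-x_i : 1\le i\le n\rangle\Bigr)\cap\mathbb{K}[\mathbf{x}].$$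 The $r$-th secant variety $X_{\mathcal{A}}^{\{r\}}$ (the Zariski closure of the union of the spans of $r$ points of $X_{\mathcal{A}}$) is the subvariety of $\mathbb{P}^{n-1}$ defined by $I_{\mathcal{A}}^{\{r\}}$. Regular triangulations: for a term order $\prec$ on $\mathbb{K}[\mathbf{x}]$, the radical of the initial ideal $\mathrm{in}_\prec(I_{\mathcal{A}})$ is a squarefree monomial ideal, and the associated simplicial complex $\Delta_\prec(\mathcal{A})$ on $\mathcal{A}$, in which $\{a_{i_1},\ldots,a_{i_k}\}$ is a simplex if and only if no power of $x_{i_1}\cdots x_{i_k}$ lies in $\mathrm{in}_\prec(I_{\mathcal{A}})$, is a regular triangulation of $\mathcal{A}$; every regular triangulation of $\mathcal{A}$ has this form. A triangulation of $\mathcal{A}$ is full if every point of $\mathcal{A}$ is a vertex of some simplex of it. For a full triangulation $\Delta$, a subset $C\subseteq\mathcal{A}$ is $r$-partitionable if $C$ is the disjoint union of (the vertex sets of) $r$ maximal simplices of $\Delta$; then $|C|=rd$. *)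

(* Defs.v *)
From HB Require Import structures.
From mathcomp Require Import all_boot all_order all_algebra.
From mathcomp Require Import fraction.
From mathcomp Require Import mpoly.

Set Implicit Arguments.
Unset Strict Implicit.
Unset Printing Implicit Defensive.

Import Order.TTheory GRing.Theory Num.Theory.
Local Open Scope ring_scope.

(* Subsets of a ring, in particular ideals, are Prop-valued predicates: no
   decidability is assumed. *)
Definition ideal_gen (R : comNzRingType) (S : R -> Prop) (p : R) : Prop :=
  exists2 s : seq (R * R),
    (forall q, q \in s -> S q.2) & p = \sum_(q <- s) q.1 * q.2.

Section Toric.
Variables (K : fieldType) (d n : nat) (A : 'M[int]_(d, n)).

(* The Laurent polynomial ring K[t_1^{+-1}, ..., t_d^{+-1}] is the subring of the
   rational function field K(t_1, ..., t_d) generated by K, the t_i and their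
   inverses, so the kernel may be taken in K(t_1, ..., t_d). *)
Definition laurent_monomial (j : 'I_n) : {fraction {mpoly K[d]}} :=
  \prod_(i < d) (@tofrac {mpoly K[d]} 'X_i) ^ (A i j).

Definition toric_ideal (p : {mpoly K[n]}) : Prop :=
  mmap (fun c : K => @tofrac {mpoly K[d]} c%:MP) laurent_monomial p = 0.

End Toric.

Arguments toric_ideal K {d n} A p.

Section Secant.
Variables (K : fieldType) (n r : nat).

(* K[x, y_1, ..., y_r]: the first n variables are x_1, ..., x_n, and the other
   r * n are the y_{ji}. *)
Definition xvar (i : 'I_n) : {mpoly K[n + r * n]} := 'X_(lshift (r * n) i).
Definition yvar (j : 'I_r) (i : 'I_n) : {mpoly K[n + r * n]} :=
  'X_(rshift n (mxvec_index j i)).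

Definition secant_generator (I : {mpoly K[n]} -> Prop)
    (g : {mpoly K[n + r * n]}) : Prop :=
  (exists j : 'I_r, exists2 f, I f & g = f \mPo [tuple yvar j i | i < n]) \/
  (exists i : 'I_n, g = \sum_(j < r) yvar j i - xvar i).

Definition secant_ideal (I : {mpoly K[n]} -> Prop) (f : {mpoly K[n]}) : Prop :=
  ideal_gen (secant_generator I) (f \mPo [tuple xvar i | i < n]).

End Secant.

Section Hilbert.
Variables (K : fieldType) (n : nat) (I : {mpoly K[n]} -> Prop).

(* h = dim_K (K[x]_m / I_m): the classes of the b i form a basis of the quotient. *)
Definition hilbert_function_at (m h : nat) : Prop :=
  exists b : 'I_h -> {mpoly K[n]},
    [/\ forall i, b i \is m.-homog,
        forall c : 'I_h -> K, I (\sum_i c i *: b i) -> forall i, c i = 0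
      & forall p, p \is m.-homog ->
          exists c : 'I_h -> K, I (p - \sum_i c i *: b i)].

Definition hilbert_polynomial (P : {poly rat}) : Prop :=
  exists N : nat, forall m : nat, (N <= m)%N ->
    exists2 h : nat, hilbert_function_at m h & P.[m%:R] = h%:R.

(* Dimension and degree of the subscheme of P^(n-1) defined by the homogeneous
   ideal I.  The predicates hold for no D and no e when this subscheme is empty,
   i.e. when the Hilbert polynomial is zero. *)
Definition proj_dimension (D : nat) : Prop :=
  exists2 P : {poly rat}, hilbert_polynomial P & size P = D.+1.

Definition proj_degree (e : rat) : Prop :=
  exists2 P : {poly rat}, hilbert_polynomial P &
    exists2 D : nat, size P = D.+1 & e = lead_coef P * (D`!)%:R.

End Hilbert.

Section TermOrder.
Variables (n : nat) (le : rel 'X_{1..n}).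

Definition term_order : Prop :=
  [/\ total le, transitive le, antisymmetric le,
      forall m, le 0%MM m
    & forall m1 m2 m, le m1 m2 -> le (m1 + m)%MM (m2 + m)%MM].

Definition leading_monomial (K : fieldType) (p : {mpoly K[n]})
    (m : 'X_{1..n}) : Prop :=
  m \in msupp p /\ (forall m', m' \in msupp p -> le m' m).

Definition initial_ideal (K : fieldType) (I : {mpoly K[n]} -> Prop) :
    {mpoly K[n]} -> Prop :=
  ideal_gen (fun q => exists p m, [/\ I p, leading_monomial p m & q = 'X_[m]]).

End TermOrder.

(* The points of the configuration are the columns a_j of A, identified with
   their indices j : 'I_n. *)
Definition regular_triangulation (K : fieldType) (d n : nat)
    (A : 'M[int]_(d, n)) (Delta : {set {set 'I_n}}) : Prop :=
  exists2 le : rel 'X_{1..n}, term_order le &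
    forall S : {set 'I_n}, S \in Delta <->
      forall k : nat,
        ~ initial_ideal le (toric_ideal K A) ((\prod_(i in S) 'X_i) ^+ k).

Section Partitionable.
Variables (n : nat) (Delta : {set {set 'I_n}}).

Definition full_complex : bool := cover Delta == [set: 'I_n].

Definition facets : {set {set 'I_n}} :=
  [set S | maxset [pred T | T \in Delta] S].

Definition r_partitionable (r : nat) (C : {set 'I_n}) : bool :=
  [exists P : {set {set 'I_n}},
    [&& P \subset facets, #|P| == r & partition P C]].

End Partitionable.

(* Main.v *)
Require Import Defs.
From HB Require Import structures.
From mathcomp Require Import all_boot all_order all_algebra.
From mathcomp Require Import fraction ssrcomplements mpoly.
From mathcomp Require Import zify ring polyrcf.
From Stdlib Require Import Classical ClassicalEpsilon.

(** A polynomial f lies in the secant ideal iff f(y_1 + ... + y_r) is killed by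
    y_ji |-> t_j^(a_i), that is, iff for every tuple (c_j) of vectors of Z^d the
    coefficients of the monomials y^v with A v_j = c_j for all j add up to 0.

    Upper bound: the Hilbert function at m is at most the number of tuples
    (A v_j) with |v| = m.  Their entries are O(m) and satisfy one linear equation
    coming from the grading, so there are O(m^(rd-1)) of them.

    Lower bound: let x^u be the leading monomial of an f in the secant ideal, and
    suppose that u is supported on a disjoint union of faces S_1, ..., S_r.  Then
    v = (u restricted to S_j)_j has coefficient f_u in f(y_1 + ... + y_r), so its
    fibre contains another monomial v' of that polynomial.  Monomials supported on
    a face are standard, hence minimal in their fibre, so v_j <= v'_j and
    u = sum_j v_j < sum_j v'_j, although the latter is an exponent of f.  Thus all
    such x^u are standard, and the u with support exactly C, |C| = rd, and degree
    m are 'C(m-1, rd-1) in number.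

    Facets have d elements: a facet S with fewer than d elements would force the
    fibre-minimal exponents of A (b + t 1_S), t large, to be large on S (by
    Dickson's lemma) and bounded off S, which is absurd when a linear form
    vanishing on S takes a large value on A b. *)

Set Implicit Arguments.
Unset Strict Implicit.
Unset Printing Implicit Defensive.

Import Order.TTheory GRing.Theory Num.Theory.

(** * Dickson's lemma and Hilbert polynomials of monomial ideals *)

(** Every tail of [u] attains its minimum. Taking a minimizing index of the tail, then one of the
    tail strictly after it, and so on, gives [g]. *)
Lemma nat_monotone_subseq (u : nat -> nat) :
  exists2 g : nat -> nat, {homo g : i j / i < j} & {homo u \o g : i j / i <= j}.
Proof.
have minP N : exists i, N <= i /\ forall j, N <= j -> u i <= u j.
  suff: forall v i, N <= i -> u i <= v ->
      exists i, N <= i /\ forall j, N <= j -> u i <= u j.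
    by move=> /(_ (u N) N); apply.
  elim=> [|v IHv] i leNi ui; first by exists i; split=> // j _; lia.
  have [[j [leNj uj]]|no] := classic (exists j, N <= j /\ u j < u i).
    by apply: (IHv j) => //; lia.
  exists i; split=> // j leNj; rewrite leqNgt; apply/negP=> uji.
  by apply: no; exists j.
have [f fP] := choice _ minP.
pose g := fix g k := if k is k'.+1 then f (g k').+1 else f 0.
have gS k : g k < g k.+1 by case: (fP (g k).+1).
exists g; first exact: (homo_ltn ltn_trans).
apply: (homo_leq leqnn leq_trans) => -[|k] /=.
  by case: (fP 0) => _; apply.
case: (fP (g k).+1) => le1 le2; apply: le2 => /=.
by have /= := gS k.+1; lia.
Qed.

(** Dickson's lemma for the vectors [u k], of which only the first [n] coordinates matter: the
    subsequence is refined once for each coordinate. *)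
Lemma dickson_subseq n (u : nat -> nat -> nat) :
  exists2 g : nat -> nat, {homo g : i j / i < j} &
    forall c, c < n -> {homo (fun k => u (g k) c) : i j / i <= j}.
Proof.
elim: n => [|n [g g_mono gP]]; first by exists id.
have [h h_mono hP] := nat_monotone_subseq (fun k => u (g k) n).
exists (g \o h) => [i j /h_mono/g_mono //|c].
rewrite ltnS leq_eqVlt => /predU1P[-> //|ltcn] i j leij /=.
by apply: gP => //; apply: (ltnW_homo h_mono).
Qed.

(** Upsets are the exponent sets of monomial ideals. [all2] relates only sequences of equal
    length. *)
Definition is_upset (U : pred (seq nat)) : Prop :=
  forall s t, all2 leq s t -> U s -> U t.

(** The ascending chain condition for monomial ideals. In a chain that keeps growing, pick at each
    growth a vector that is new. By Dickson's lemma one of them lies below a later one, which is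
    then not new. *)
Lemma upset_chain_stable n (U : nat -> pred (seq nat)) :
    (forall k, is_upset (U k)) -> (forall k s, U k s -> U k.+1 s) ->
  exists k0, forall k s, k0 <= k -> size s = n -> U k s = U k0 s.
Proof.
move=> upU chU; apply: NNPP => nostab.
have chainU i j s : i <= j -> U i s -> U j s.
  by move/subnK <-; elim: (j - i) => //= k IHk /IHk /chU.
have next k0 : exists ks : nat * seq nat,
    [/\ k0 < ks.1, size ks.2 = n, U ks.1 ks.2 & ~~ U k0 ks.2].
  apply: NNPP => no; apply: nostab; exists k0 => k s lek sz.
  apply/idP/idP => [Uk|]; last exact: chainU.
  apply/negPn/negP => nU; apply: no; exists (k, s); split=> //=.
  by rewrite ltn_neqAle lek andbT; apply: contraNneq nU => ->.
have [f fP] := choice _ next.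
pose h := fix h k := if k is k'.+1 then (f (h k')).1 else 0.
have hS k : h k < h k.+1 by case: (fP (h k)).
have h_mono : {homo h : i j / i < j} by exact: (homo_ltn ltn_trans).
have [g g_mono gP] := dickson_subseq n (fun k => nth 0 (f (h k)).2).
have lt01 : g 0 < g 1 by exact: g_mono.
have [_ sz0 U0 _] := fP (h (g 0)); have [_ sz1 _ /negP[]] := fP (h (g 1)).
apply: (@upU _ (f (h (g 0))).2); last first.
  by apply: chainU U0; apply: (ltnW_homo h_mono lt01).
rewrite all2E sz0 sz1 eqxx /=; apply/(all_nthP (0, 0)) => i.
rewrite size_zip sz0 sz1 minnn => lti.
by rewrite nth_zip ?sz0 ?sz1 //=; apply: gP.
Qed.

(** * Counting exponent vectors of given degree and support *)

Fixpoint compositions (n m : nat) : seq (seq nat) :=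
  if n is n'.+1 then
    flatten [seq [seq k :: s | s <- compositions n' (m - k)] | k <- iota 0 m.+1]
  else if m is 0 then [:: [::]] else [::].

Lemma compositionsS n m : compositions n.+1 m =
  flatten [seq [seq k :: s | s <- compositions n (m - k)] | k <- iota 0 m.+1].
Proof. by []. Qed.

Lemma mem_compositions n m s :
  (s \in compositions n m) = (size s == n) && (sumn s == m).
Proof.
elim: n m s => [[|m] [|x s]|n IHn m s] //.
rewrite compositionsS.
apply/idP/idP => [/flatten_mapP[k]|].
  rewrite mem_iota add0n => /= lek /mapP[t]; rewrite IHn => /andP[/eqP sz /eqP sm] ->.
  by rewrite /= sz sm eqxx; apply/eqP; lia.
case: s => [|k s] //; rewrite [size _]/= [sumn _]/= eqSS => /andP[/eqP sz /eqP sm].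
apply/flatten_mapP; exists k; first by rewrite mem_iota; lia.
by apply: map_f; rewrite IHn sz eqxx; apply/eqP; lia.
Qed.

Lemma compositions_uniq n m : uniq (compositions n m).
Proof.
elim: n m => [[|m]|n IHn m] //.
rewrite compositionsS.
apply/(@allpairs_uniq_dep _ (fun=> seq nat) _ (fun k s => k :: s) (iota 0 m.+1)
  (fun k => compositions n (m - k))) => //; first exact: iota_uniq.
move=> [k s] [k' s'] _ _ /=.
by case=> -> ->.
Qed.

Lemma count_compositionsS (a : pred (seq nat)) n m :
  count a (compositions n.+1 m) =
  \sum_(k < m.+1) count (fun s => a ((k : nat) :: s)) (compositions n (m - k)).
Proof.
rewrite compositionsS count_flatten -map_comp sumnE big_map.
rewrite -[iota 0 m.+1]/(index_iota 0 m.+1) big_mkord.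
by apply: eq_bigr => k _; rewrite /= count_map.
Qed.

Lemma sum_bin_lt c m : \sum_(k < m) 'C(k, c) = 'C(m, c.+1).
Proof.
elim: m => [|m IHm]; first by rewrite big_ord0.
by rewrite big_ord_recr /= IHm binS.
Qed.

(** Stars and bars, by recursion on [C]: an entry off the support is 0, an entry on it leaves any
    smaller degree to the others, and [sum_bin_lt] adds up the cases. *)
Lemma count_exact_support (C : bitseq) m : 0 < m -> 0 < count id C ->
  count (fun s => [seq 0 < x | x <- s] == C) (compositions (size C) m) =
  'C(m.-1, (count id C).-1).
Proof.
pose e C m := count (fun s => [seq 0 < x | x <- s] == C)
  (compositions (size C) m).
have e_false D l : e (false :: D) l = e D l.
  rewrite /e [size _]/= count_compositionsS big_ord_recl /= subn0 big1 ?addn0 //.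
  by move=> i _; rewrite (eq_count (a2 := pred0)) ?count_pred0.
have e_true D l : e (true :: D) l = \sum_(k < l) e D k.
  rewrite /e [size _]/= count_compositionsS big_ord_recl /=.
  rewrite (eq_count (a2 := pred0)) ?count_pred0 // add0n.
  rewrite (reindex_inj rev_ord_inj) /=; apply: eq_bigr => i _.
  congr (count _ (compositions _ _)); have := ltn_ord i.
  by rewrite /bump /=; lia.
(* The recursion also meets degree 0 and empty supports, where the truncated predecessors would give
   wrong values. *)
suff eE D l : e D l = if count id D is c.+1 then
    (if l is l'.+1 then 'C(l', c) else 0) else (l == 0).
  by rewrite -/(e C m) eE; case: m => // m _; case: (count id C).
elim: D l => [|[] D IHD] l; first by case: l.
  rewrite e_true; under eq_bigr do rewrite IHD.
  rewrite /=.
  case: (count id D) => [|c]; case: l => [|l]; rewrite ?big_ord0 //.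
    by rewrite big_ord_recl big1 ?bin0.
  by rewrite big_ord_recl /= -sum_bin_lt.
by rewrite e_false IHD.
Qed.

Local Open Scope ring_scope.

(** * Functions that agree with a polynomial for large arguments *)

Definition eventually_poly (H : nat -> nat) (P : {poly rat}) : Prop :=
  exists N : nat, forall m : nat, (N <= m)%N -> P.[m%:R] = (H m)%:R.

Lemma poly_antidifference (P : {poly rat}) :
  exists Q : {poly rat}, forall m : nat, Q.[m.+1%:R] - Q.[m%:R] = P.[m%:R].
Proof.
have [s] := ubnP (size P); elim: s P => // s IHs P; rewrite ltnS => szP.
case: s => [|s] in IHs szP *.
  exists 0 => m; move: szP; rewrite leqn0 size_poly_eq0 => /eqP->.
  by rewrite !horner0 subr0.
(* [T] is the difference of X^(s+1); its leading coefficient is s+1 in degree s, so [c *: T] cancels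
   the top coefficient of [P]. *)
pose c := P`_s / s.+1%:R; pose T : {poly rat} := ('X + 1) ^+ s.+1 - 'X^(s.+1).
have [|Q QP] := IHs (P - c *: T).
  rewrite ltnS; apply/leq_sizeP => j lesj.
  rewrite coefB coefZ /T coefB coefXn exprD1n coef_sum.
  have -> : \sum_(i < s.+2) ('X ^+ i *+ 'C(s.+1, i) : {poly rat})`_j = 'C(s.+1, j)%:R.
    have [ltjs|lesj'] := ltnP j s.+2; last first.
      rewrite bin_small // big1 // => i _; rewrite coefMn coefXn.
      by case: eqP => [ji|_]; [move: (ltn_ord i); lia | rewrite mul0rn].
    rewrite (bigD1 (Ordinal ltjs)) //= coefMn coefXn eqxx big1 ?addr0 //.
    move=> i neij; rewrite coefMn coefXn; case: eqP => [ji|_]; last by rewrite mul0rn.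
    by case/eqP: neij; apply/val_inj.
  move: lesj; rewrite leq_eqVlt => /predU1P[<-|].
    rewrite ltn_eqF // subr0 binSn /c.
    by rewrite divfK ?subrr // pnatr_eq0.
  rewrite leq_eqVlt => /predU1P[<-|ltsj].
    by rewrite eqxx binn subrr mulr0 subr0 nth_default.
  rewrite gtn_eqF // bin_small // subrr mulr0 subr0 nth_default //.
  by rewrite (leq_trans szP) // ltnW.
exists (Q + c *: 'X^(s.+1)) => m.
have := QP m; rewrite /T !hornerE -natr1 => {}QP.
rewrite [LHS](_ : _ = Q.[m%:R + 1] - Q.[m%:R] +
  c * ((m%:R + 1) ^+ s.+1 - m%:R ^+ s.+1)); last by ring.
by rewrite QP subrK.
Qed.

Lemma eventually_poly_ext H H' P (N : nat) :
    (forall m, (N <= m)%N -> H m = H' m) ->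
  eventually_poly H P -> eventually_poly H' P.
Proof.
move=> eqH [M MP]; exists (maxn N M) => m; rewrite geq_max => /andP[leN leM].
by rewrite MP // eqH.
Qed.

Lemma eventually_polyD H1 H2 P1 P2 :
    eventually_poly H1 P1 -> eventually_poly H2 P2 ->
  eventually_poly (fun m => H1 m + H2 m)%N (P1 + P2).
Proof.
move=> [N NP] [M MP]; exists (maxn N M) => m; rewrite geq_max => /andP[leN leM].
by rewrite hornerD NP // MP // natrD.
Qed.

Lemma eventually_poly_shift (k : nat) H P : eventually_poly H P ->
  eventually_poly (fun m => H (m - k)%N) (P \Po ('X - k%:R%:P)).
Proof.
move=> [N NP]; exists (N + k)%N => m lem.
rewrite horner_comp !hornerE -natrB ?NP //; lia.
Qed.

Lemma eventually_poly_sum (n : nat) (H : nat -> nat -> nat) :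
    (forall k, exists P, eventually_poly (H k) P) ->
  exists P, eventually_poly (fun m => \sum_(k < n) H k m)%N P.
Proof.
move=> HP; elim: n => [|n [P IHP]].
  by exists 0, 0%N => m _; rewrite big_ord0 horner0.
have [Q HQ] := HP n; exists (P + Q).
apply: (@eventually_poly_ext _ _ _ 0) (eventually_polyD IHP HQ) => m _.
by rewrite big_ord_recr.
Qed.

(** The partial sums telescope to an antidifference of [P] at m+1; the constant [c] absorbs the
    values of [H] before it agrees with [P]. *)
Lemma eventually_poly_psum H P : eventually_poly H P ->
  exists Q, eventually_poly (fun m => \sum_(k < m.+1) H k)%N Q.
Proof.
move=> [N NP]; have [Q QP] := poly_antidifference P.
pose c := (\sum_(k < N.+1) H k)%:R - Q.[N.+1%:R].
exists (Q \Po ('X + 1%:P) + c%:P), N => m /subnK <-.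
rewrite hornerD hornerC horner_comp hornerD hornerX hornerC natr1.
elim: (m - N)%N => [|k IHk]; first by rewrite add0n /c addrC subrK.
rewrite big_ord_recr /= natrD -{}IHk addSn -NP; last by lia.
by rewrite -QP; ring.
Qed.

(** Slice [U] by the first coordinate [k]. The slices increase with [k] and are constant from some
    [k0] on, so the count is a sum of [k0] shifted polynomials and a partial sum for the stable
    slice. *)
Theorem upset_hilbert_polynomial n (U : pred (seq nat)) : is_upset U ->
  exists P, eventually_poly (fun m => count (predC U) (compositions n m)) P.
Proof.
elim: n U => [|n IHn] U upU.
  by exists 0, 1%N => -[|m] // _; rewrite horner0.
pose V k s := U (k :: s).
have upV k : is_upset (V k) by move=> s t st; apply: upU; rewrite /= leqnn.
have chV k s : V k s -> V k.+1 s.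
  apply: upU; rewrite /= leqnSn; elim: s => //= x s ->; by rewrite leqnn.
have [k0 k0P] := upset_chain_stable n upV chV.
have [P PP] := IHn _ (upV k0); have [Q QP] := eventually_poly_psum PP.
have [|S SP] := @eventually_poly_sum k0
  (fun k m => count (predC (V k)) (compositions n (m - k))).
  by move=> k; have [R RP] := IHn _ (upV k); 
    by exists (R \Po ('X - k%:R%:P)); apply: (eventually_poly_shift k RP).
exists (S + (Q \Po ('X - k0%:R%:P))).
apply: (@eventually_poly_ext _ _ _ k0)
  (eventually_polyD SP (eventually_poly_shift k0 QP)) => m lek0.
rewrite count_compositionsS.
rewrite -(big_mkord xpredT (fun k => count (predC (V k)) (compositions n (m - k)))).
rewrite -[RHS](big_mkord xpredT (fun k => count (predC (V k)) (compositions n (m - k)))).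
rewrite [RHS](big_cat_nat (n := k0)) //=; last by lia.
congr (_ + _)%N; rewrite -[in RHS](add0n k0) big_addn subSn // big_mkord.
rewrite (reindex_inj rev_ord_inj) /=; apply: eq_bigr => i _.
rewrite subSS -subnDA addnC.
apply/eq_in_count => s; rewrite mem_compositions => /andP[/eqP sz _] /=.
by rewrite k0P //; lia.
Qed.

(** * Comparison of polynomials by their leading coefficients *)

Lemma eventually_ge0_lead_coef (P : {poly rat}) (N : nat) :
  (forall m : nat, (N <= m)%N -> 0 <= P.[m%:R]) -> 0 <= lead_coef P.
Proof.
move=> PN; rewrite leNgt -oppr_gt0 -lead_coefN; apply/negP => /[dup] lcP.
move=> /poly_pinfty_gt_lc[x xP].
pose m := maxn N (Num.bound `|x|).
have /xP : x <= m%:R.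
  apply: le_trans (ler_norm x) _; apply: ltW; apply: lt_le_trans (archi_boundP _) _ => //.
  by rewrite ler_nat /m leq_maxr.
rewrite hornerN => /(lt_le_trans lcP); rewrite oppr_gt0 ltNge PN //.
exact: leq_maxl.
Qed.

Lemma ffact_lower_bound c n : (c <= n)%N -> ((n.+1 - c) ^ c <= n ^_ c)%N.
Proof.
elim: c => [|c IHc] // ltcn; rewrite ffactnSr expnSr subSS leq_mul2r.
apply/orP; right; apply: leq_trans (IHc (ltnW ltcn)).
by case: c {IHc ltcn} => // c; rewrite leq_exp2r //; lia.
Qed.

(** [P] is squeezed between [L], of degree c with leading coefficient N/c!, and [U], of degree at
    most c. [U] bounds the degree from above; [L] bounds it from below and then also bounds the
    leading coefficient. *)
Lemma growth_lead_coef (P : {poly rat}) (N c b B M : nat) : (0 < N)%N ->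
    (forall m : nat, (M <= m)%N -> (N * 'C(m.-1, c))%:R <= P.[m%:R]) ->
    (forall m : nat, (M <= m)%N -> P.[m%:R] <= ((B * m + b) ^ c)%:R) ->
  size P = c.+1 /\ N%:R <= lead_coef P * c`!%:R.
Proof.
move=> N_gt0 lowP uppP.
pose L : {poly rat} := (N%:R / c`!%:R) *: ('X - c%:R%:P) ^+ c.
pose U : {poly rat} := (B%:R *: 'X + b%:R%:P) ^+ c.
have fact_neq0 : c`!%:R != 0 :> rat by rewrite pnatr_eq0 -lt0n fact_gt0.
have a_gt0 : 0 < N%:R / c`!%:R :> rat.
  by rewrite divr_gt0 ?ltr0n ?fact_gt0.
have szL : size L = c.+1.
  by rewrite size_scale ?gt_eqF // size_exp_XsubC.
have lcL : lead_coef L = N%:R / c`!%:R.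
  by rewrite lead_coefZ (monicP (monic_exp _ (monicXsubC _))) mulr1.
have szU : (size U <= c.+1)%N.
  apply: leq_trans (size_poly_exp_leq _ _) _; rewrite ltnS.
  rewrite -[X in (_ <= X)%N]mul1n leq_mul2r; apply/orP; right.
  rewrite -subn1 leq_subLR (leq_trans (size_polyD _ _)) // geq_max.
  rewrite (leq_trans (size_scale_leq _ _)) ?size_polyX //.
  by rewrite (leq_trans (size_polyC_leq1 _)).
(* Each of the c factors of the falling factorial c! 'C(m-1, c) is at least m-c. *)
have LP : 0 <= lead_coef (P - L).
  apply: (@eventually_ge0_lead_coef _ (maxn M c.+1)) => m.
  rewrite geq_max => /andP[leM ltc]; rewrite hornerD hornerN subr_ge0.
  apply: le_trans (lowP m leM); rewrite natrM hornerZ -mulrA ler_pM2l ?ltr0n //.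
  rewrite mulrC ler_pdivrMr ?ltr0n ?fact_gt0 // -natrM bin_ffact.
  rewrite horner_exp hornerXsubC -natrB; last by lia.
  rewrite -natrX ler_nat; apply: leq_trans (ffact_lower_bound _); last by lia.
  by rewrite prednK //; apply: leq_trans ltc.
have P_ge0 : 0 <= lead_coef P.
  by apply: (@eventually_ge0_lead_coef _ M) => m /lowP; apply: le_trans; exact: ler0n.
have UP : 0 <= lead_coef (U - P).
  apply: (@eventually_ge0_lead_coef _ M) => m /uppP.
  by rewrite hornerD hornerN subr_ge0 /U horner_exp !hornerE natrX natrD natrM.
have leLP : (c < size P)%N.
  rewrite ltnNge -ltnS -szL; apply/negP => ltPL; move: LP.
  by rewrite lead_coefDr ?size_polyN // lead_coefN lcL oppr_ge0 leNgt a_gt0.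
have lcP_gt0 : 0 < lead_coef P.
  by rewrite lt_def P_ge0 andbT lead_coef_eq0 -size_poly_gt0 (leq_trans _ leLP).
have szP : size P = c.+1.
  apply/eqP; rewrite eqn_leq leLP andbT leqNgt; apply/negP => ltcP; move: UP.
  rewrite lead_coefDr ?size_polyN ?(leq_ltn_trans szU) //.
  by rewrite lead_coefN oppr_ge0 leNgt lcP_gt0.
split=> //; rewrite -ler_pdivrMr ?ltr0n ?fact_gt0 // -lcL -subr_ge0.
rewrite !lead_coefE szP szL /= -coefB; move: LP.
have [->|nz] := eqVneq ((P - L)`_c) 0; first by [].
rewrite lead_coefE (_ : size (P - L) = c.+1) //; apply/eqP.
rewrite eqn_leq; apply/andP; split.
  by rewrite (leq_trans (size_polyD _ _)) // size_polyN szP szL maxnn.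
by rewrite ltnNge; apply: contraNN nz => /leq_sizeP->.
Qed.

(** * Fibre sums and toric ideals *)

Section FibreSum.
Variables (K : fieldType) (n : nat) (T : eqType) (w : 'X_{1..n} -> T).
Implicit Types (p q : {mpoly K[n]}) (c : T).

(** The coefficient of t^c in the image of [p] under x^m -> t^(w m). Accordingly, [fibre_null]
    describes the kernel of this map. *)
Definition fibre_sum c p : K := \sum_(m <- msupp p | w m == c) p@_m.

(** A common bound [k] gives several polynomials one index set, from which linearity follows. *)
Lemma fibre_sumE c p k : (msize p <= k)%N ->
  fibre_sum c p = \sum_(m : 'X_{1..n < k} | w m == c) p@_m.
Proof.
move=> le_pk; rewrite /fibre_sum big_mkcond [RHS]big_mkcond /=.
rewrite (big_mksub 'X_{1..n < k}) ?msupp_uniq //=; last first.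
  by move=> x /msize_mdeg_lt /leq_trans; apply.
by rewrite big_rmcond //= => j /memN_msupp_eq0 ->; case: ifP.
Qed.

Lemma fibre_sum_is_linear c : linear_for *%R (fibre_sum c).
Proof.
move=> a p q; pose k := maxn (msize (a *: p + q)) (maxn (msize p) (msize q)).
rewrite !(@fibre_sumE _ _ k) /k; try by rewrite !leq_max leqnn ?orbT.
rewrite mulr_sumr -big_split /=; apply: eq_bigr => m _.
by rewrite mcoeffD mcoeffZ.
Qed.

HB.instance Definition _ c :=
  GRing.isLinear.Build K {mpoly K[n]} K *%R (fibre_sum c)
    (fibre_sum_is_linear c).

Lemma fibre_sumX c m : fibre_sum c 'X_[m] = (w m == c)%:R.
Proof.
rewrite /fibre_sum msuppX big_mkcond big_seq1 mcoeffX eqxx.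
by case: ifP.
Qed.

Definition fibre_null p : Prop := forall c, fibre_sum c p = 0.

(** With one representative for each fibre, the subtracted terms at a representative add up to its
    fibre sum, which is 0. Both monomials of every binomial come from the support of [p], so
    conditions on that support apply to them. *)
Lemma fibre_null_sub_rep p : fibre_null p ->
  exists2 rep : 'X_{1..n} -> 'X_{1..n},
    {in msupp p, forall m, rep m \in msupp p /\ w (rep m) = w m} &
    p = \sum_(m <- msupp p) p@_m *: ('X_[m] - 'X_[rep m]).
Proof.
move=> p0; pose rp c := head 0%MM [seq m <- msupp p | w m == c].
have wrp m : m \in msupp p -> rp (w m) \in msupp p /\ w (rp (w m)) = w m.
  move=> mp; rewrite /rp; case E: [seq _ <- _ | _] => [|u s] /=.
    by have := mem_filter (fun m' => w m' == w m) m (msupp p); rewrite E mp /= eqxx.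
  have : u \in [seq m' <- msupp p | w m' == w m] by rewrite E mem_head.
  by rewrite mem_filter => /andP[/eqP].
exists (rp \o w) => //=.
under eq_bigr do rewrite scalerBr.
rewrite sumrB -mpolyE [X in _ - X](_ : _ = 0) ?subr0 //.
apply/mpolyP => u; rewrite mcoeff0 raddf_sum /=.
have [eu|neu] := eqVneq (rp (w u)) u; last first.
  rewrite big_seq big1 // => m mp; rewrite mcoeffZ mcoeffX.
  case: eqP => [E|_]; last by rewrite mulr0.
  by case/eqP: neu; rewrite -E; case: (wrp m mp) => _ ->.
rewrite -[RHS](p0 (w u)) /fibre_sum [RHS]big_mkcond [LHS]big_seq [RHS]big_seq.
apply: eq_bigr => m mp; rewrite mcoeffZ mcoeffX /=.
case: (eqVneq (w m) (w u)) => [->|ne]; first by rewrite eu eqxx mulr1.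
case: eqP => [E|_]; last by rewrite mulr0.
by case/eqP: ne; case: (wrp m mp) => _ <-; rewrite E.
Qed.

End FibreSum.

(** Multiplication by x^m translates the fibres by [w m]. *)
Lemma fibre_null_mull (K : fieldType) n (T : zmodType) (w : 'X_{1..n} -> T)
    (p q : {mpoly K[n]}) :
  {morph w : m1 m2 / (m1 + m2)%MM >-> m1 + m2} ->
  fibre_null w p -> fibre_null w (q * p).
Proof.
move=> wD p0 c; rewrite [q]mpolyE mulr_suml raddf_sum big1 // => m _ /=.
rewrite -scalerAl linearZ /= [X in _ * X](_ : _ = fibre_sum w (c - w m) p).
  by rewrite p0 mulr0.
rewrite [p in LHS]mpolyE [p in RHS]mpolyE mulr_sumr !raddf_sum.
apply: eq_bigr => u _ /=; rewrite -scalerAr -mpolyXD !linearZ /= !fibre_sumX.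
rewrite wD; congr (_ * (nat_of_bool _)%:R).
by apply/eqP/eqP => [<-|->]; rewrite ?(addrC (w m)) ?addrK ?subrK.
Qed.

Section Toric.
Variables (K : fieldType) (d n : nat) (A : 'M[int]_(d, n)).

Definition toric_weight (m : 'X_{1..n}) : 'cV[int]_d := \sum_i col i A *+ m i.

Lemma toric_weightD :
  {morph toric_weight : m1 m2 / (m1 + m2)%MM >-> m1 + m2}.
Proof.
move=> m1 m2; rewrite /toric_weight -big_split; apply: eq_bigr => i _.
by rewrite mnmDE mulrnDr.
Qed.

Lemma toric_weightE m k : toric_weight m k 0 = \sum_i A k i *+ m i.
Proof.
rewrite /toric_weight summxE; apply: eq_bigr => i _.
by rewrite mulmxnE mxE.
Qed.

Definition laurent_exp (c : 'cV[int]_d) : {fraction {mpoly K[d]}} :=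
  \prod_(k < d) (@tofrac {mpoly K[d]} 'X_k) ^ (c k 0).

Lemma tofrac_var_neq0 k : @tofrac {mpoly K[d]} 'X_k != 0.
Proof. by rewrite tofrac_eq0 -msupp_eq0 msuppX. Qed.

Lemma laurent_expD c1 c2 :
  laurent_exp (c1 + c2) = laurent_exp c1 * laurent_exp c2.
Proof.
rewrite /laurent_exp -big_split; apply: eq_bigr => k _.
by rewrite mxE expfzDr // tofrac_var_neq0.
Qed.

Lemma laurent_exp0 : laurent_exp 0 = 1.
Proof. by rewrite /laurent_exp big1 // => k _; rewrite mxE. Qed.

Lemma laurent_exp_nat (e : 'X_{1..d}) :
  laurent_exp (\col_k (e k)%:Z) = @tofrac {mpoly K[d]} 'X_[e].
Proof.
rewrite /laurent_exp mpolyXE_id rmorph_prod; apply: eq_bigr => k _.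
by rewrite mxE rmorphXn.
Qed.

Lemma mmap1_laurent m : mmap1 (laurent_monomial K A) m = laurent_exp (toric_weight m).
Proof.
rewrite /mmap1 /toric_weight (big_morph _ laurent_expD laurent_exp0).
apply: eq_bigr => i _; elim: (m i) => [|k IHk].
  by rewrite expr0 mulr0n laurent_exp0.
rewrite exprS IHk mulrS laurent_expD; congr (_ * _).
by apply: eq_bigr => k' _; rewrite mxE.
Qed.

Lemma toric_binomial m1 m2 : toric_weight m1 = toric_weight m2 ->
  toric_ideal K A ('X_[m1] - 'X_[m2]).
Proof.
move=> eq12; rewrite /toric_ideal -[fun c => _]/(@tofrac {mpoly K[d]} \o @mpolyC d K).
by rewrite mmapB !mmapX !mmap1_laurent eq12 subrr.
Qed.

(** Distinct Laurent monomials are linearly independent: a common monomial factor turns those of [p]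
    into monomials of K[t], where coefficients can be read off. *)
Lemma toric_fibre_null p : toric_ideal K A p -> fibre_null toric_weight p.
Proof.
move=> Ip c.
have [/hasP[m0 m0p /eqP <-]|/hasPn noc] :=
    boolP (has (fun m => toric_weight m == c) (msupp p)); last first.
  rewrite /fibre_sum big_seq_cond big1 // => m /andP[/noc /negP nc /eqP mc].
  by case: nc; rewrite mc.
(* Adding [B] to all entries makes every weight that occurs in [p] nonnegative. *)
pose B := (\sum_(m <- msupp p) \sum_k absz (toric_weight m k ord0))%N.
pose e m : 'X_{1..d} := [multinom absz (toric_weight m k ord0 + B%:Z)%R | k < d].
have eE m : m \in msupp p ->
    \col_k (e m k)%:Z = toric_weight m + const_mx B%:Z.
  move=> mp; apply/colP => k; rewrite !mxE mnmE gez0_abs //.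
  have : (absz (toric_weight m k ord0) <= B)%N.
    by rewrite /B (big_rem m mp) (bigD1 k) //= -!addnA leq_addr.
  by lia.
have e_inj m : m \in msupp p -> (e m == e m0) = (toric_weight m == toric_weight m0).
  move=> mp; apply/eqP/eqP => [E|E]; last first.
    by apply/mnmP => k; rewrite !mnmE E.
  by apply: (addIr (const_mx B%:Z)); rewrite -!eE // E.
have : \sum_(m <- msupp p) p@_m *: 'X_[e m] = 0 :> {mpoly K[d]}.
  apply/eqP; rewrite -tofrac_eq0 raddf_sum /=; apply/eqP.
  have /(congr1 (fun x => x * laurent_exp (const_mx B%:Z))) := Ip.
  rewrite mul0r /mmap mulr_suml => Ip0.
  apply: etrans Ip0; rewrite big_seq [RHS]big_seq; apply: eq_bigr => m mp.
  rewrite mmap1_laurent -mulrA -laurent_expD -eE // laurent_exp_nat.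
  by rewrite -rmorphM mul_mpolyC.
move=> /(congr1 (mcoeff (e m0))); rewrite raddf_sum mcoeff0 /= => <-.
rewrite /fibre_sum big_mkcond [LHS]big_seq [RHS]big_seq; apply: eq_bigr => m mp.
by rewrite mcoeffZ mcoeffX e_inj //; case: eqP; rewrite ?mulr1 ?mulr0.
Qed.

End Toric.

(** * Fibre sums and secant ideals *)

Section IdealGen.
Variables (R : comNzRingType) (S : R -> Prop).

Lemma ideal_gen0 : ideal_gen S 0.
Proof. by exists [::]; rewrite ?big_nil. Qed.

Lemma ideal_genD p q : ideal_gen S p -> ideal_gen S q -> ideal_gen S (p + q).
Proof.
move=> [s sS ->] [t tS ->]; exists (s ++ t); last by rewrite big_cat.
by move=> u; rewrite mem_cat => /orP[/sS|/tS].
Qed.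

Lemma ideal_genM p q : ideal_gen S q -> ideal_gen S (p * q).
Proof.
move=> [s sS ->]; exists [seq (p * u.1, u.2) | u <- s].
  by move=> _ /mapP[u /sS Su ->].
by rewrite big_map mulr_sumr; apply: eq_bigr => u _; rewrite mulrA.
Qed.

Lemma mem_ideal_gen p : S p -> ideal_gen S p.
Proof.
move=> Sp; exists [:: (1, p)] => [u|]; first by rewrite inE => /eqP->.
by rewrite big_seq1 mul1r.
Qed.

Lemma ideal_genN p : ideal_gen S p -> ideal_gen S (- p).
Proof. by rewrite -mulN1r; apply: ideal_genM. Qed.

Lemma ideal_gen_sum I (r : seq I) (P : pred I) (F : I -> R) :
  (forall i, P i -> ideal_gen S (F i)) -> ideal_gen S (\sum_(i <- r | P i) F i).
Proof. by move=> FS; elim/big_ind: _ => //; [exact: ideal_gen0|exact: ideal_genD]. Qed.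

Lemma ideal_gen_subM p1 p2 q1 q2 : ideal_gen S (p1 - q1) -> ideal_gen S (p2 - q2) ->
  ideal_gen S (p1 * p2 - q1 * q2).
Proof.
move=> S1 S2; rewrite (_ : _ - _ = p2 * (p1 - q1) + q1 * (p2 - q2)); last by ring.
by apply: ideal_genD; apply: ideal_genM.
Qed.

Lemma ideal_gen_sub_prod I (r : seq I) (P : pred I) (F G : I -> R) :
    (forall i, P i -> ideal_gen S (F i - G i)) ->
  ideal_gen S (\prod_(i <- r | P i) F i - \prod_(i <- r | P i) G i).
Proof.
move=> FG; elim/big_ind2: _ => //; last by move=> *; apply: ideal_gen_subM.
by rewrite subrr; exact: ideal_gen0.
Qed.

End IdealGen.

Lemma ideal_gen_sub_comp (K : fieldType) n k (S : {mpoly K[k]} -> Prop)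
    (p : {mpoly K[n]}) (s t : n.-tuple {mpoly K[k]}) :
  (forall i, ideal_gen S (tnth s i - tnth t i)) ->
  ideal_gen S ((p \mPo s) - (p \mPo t)).
Proof.
move=> st; rewrite !comp_mpolyE -sumrB; apply: ideal_gen_sum => m _.
rewrite -scalerBr -mul_mpolyC; apply: ideal_genM.
apply: ideal_gen_sub_prod => i _; elim: (m i) => [|e IHe].
  by rewrite !expr0 subrr; exact: ideal_gen0.
by rewrite !exprS; apply: ideal_gen_subM.
Qed.

Lemma comp_mpoly_comp (K : fieldType) n k l (p : {mpoly K[n]})
    (s : n.-tuple {mpoly K[k]}) (t : k.-tuple {mpoly K[l]}) :
  (p \mPo s) \mPo t = p \mPo [tuple tnth s i \mPo t | i < n].
Proof.
rewrite (comp_mpolyEX p s) raddf_sum [RHS]comp_mpolyEX; apply: eq_bigr => m _ /=.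
rewrite comp_mpolyZ !comp_mpolyX rmorph_prod; congr (_ *: _).
by apply: eq_bigr => i _; rewrite /= rmorphXn tnth_mktuple.
Qed.

Lemma comp_mpolyM (K : fieldType) n k (s : n.-tuple {mpoly K[k]}) (p q : {mpoly K[n]}) :
  (p * q) \mPo s = (p \mPo s) * (q \mPo s).
Proof. exact: (rmorphM (comp_mpoly s)). Qed.

Lemma comp_mpoly_sum (K : fieldType) n k (s : n.-tuple {mpoly K[k]}) I (r : seq I)
    (P : pred I) (F : I -> {mpoly K[n]}) :
  (\sum_(i <- r | P i) F i) \mPo s = \sum_(i <- r | P i) (F i \mPo s).
Proof. exact: (raddf_sum (comp_mpoly s)). Qed.

Definition mxvec_pair m n (k : 'I_(m * n)) : 'I_m * 'I_n :=
  enum_val (cast_ord (esym (mxvec_cast m n)) k).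

Lemma mxvec_indexK m n (i : 'I_m) (j : 'I_n) : mxvec_pair (mxvec_index i j) = (i, j).
Proof. by rewrite /mxvec_pair cast_ordK enum_rankK. Qed.

Lemma eq_mxvec_index m n (i i' : 'I_m) (j j' : 'I_n) :
  (mxvec_index i j == mxvec_index i' j') = (i == i') && (j == j').
Proof.
apply/eqP/andP => [/(congr1 (@mxvec_pair m n))|[/eqP-> /eqP->] //].
by rewrite !mxvec_indexK => -[-> ->].
Qed.

Lemma big_mxvec_index (R : Type) (idx : R) (op : Monoid.com_law idx) m n
    (F : 'I_(m * n) -> R) :
  \big[op/idx]_k F k = \big[op/idx]_(i < m) \big[op/idx]_(j < n) F (mxvec_index i j).
Proof.
rewrite pair_bigA (reindex _ (curry_mxvec_bij _ _)) /=.
by apply: eq_bigr => -[i j].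
Qed.

Section SecantToric.
Variables (K : fieldType) (d n r : nat) (A : 'M[int]_(d, n)).

Definition yblock (j : 'I_r) (v : 'X_{1..r * n}) : 'X_{1..n} :=
  [multinom v (mxvec_index j i) | i < n].

(** The exponents of the image of y^v under y_ji -> t_j^(a_i), one vector for each group t_j. *)
Definition secant_weight (v : 'X_{1..r * n}) : {ffun 'I_r -> 'cV[int]_d} :=
  [ffun j => toric_weight A (yblock j v)].

Definition ysum : n.-tuple {mpoly K[r * n]} :=
  [tuple \sum_(j < r) 'X_(mxvec_index j i) | i < n].

Lemma yblockD j v1 v2 : yblock j (v1 + v2)%MM = (yblock j v1 + yblock j v2)%MM.
Proof. by apply/mnmP => i; rewrite !mnmE. Qed.

Lemma yblock_inj v1 v2 : (forall j, yblock j v1 = yblock j v2) -> v1 = v2.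
Proof.
move=> eqy; apply/mnmP => k; case/mxvec_indexP: k => j i.
by have /mnmP/(_ i) := eqy j; rewrite !mnmE.
Qed.

Lemma secant_weightD :
  {morph secant_weight : v1 v2 / (v1 + v2)%MM >-> v1 + v2}.
Proof. by move=> v1 v2; apply/ffunP => j; rewrite !ffunE yblockD toric_weightD. Qed.

Definition ylift (j : 'I_r) (m : 'X_{1..n}) : 'X_{1..r * n} :=
  [multinom if (mxvec_pair k).1 == j then m (mxvec_pair k).2 else 0%N | k < r * n].

Lemma yliftE j m j' i : ylift j m (mxvec_index j' i) = if j' == j then m i else 0%N.
Proof. by rewrite mnmE mxvec_indexK. Qed.

Lemma yblock_ylift j m j' : yblock j' (ylift j m) = if j' == j then m else 0%MM.
Proof. by apply/mnmP => i; rewrite mnmE yliftE; case: eqP; rewrite ?mnm0E. Qed.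

Lemma comp_mpolyX_ylift j m :
  'X_[m] \mPo [tuple 'X_(mxvec_index j i) | i < n] = 'X_[ylift j m] :> {mpoly K[r * n]}.
Proof.
rewrite comp_mpolyX [RHS]mpolyXE_id big_mxvec_index (bigD1 j) //=.
rewrite [X in _ = _ * X]big1 ?mulr1.
  by apply: eq_bigr => i _; rewrite tnth_mktuple yliftE eqxx.
by move=> j' /negPf nej; rewrite big1 // => i _; rewrite yliftE nej expr0.
Qed.

Lemma secant_fibre_null p : secant_ideal r (toric_ideal K A) p ->
  fibre_null secant_weight (p \mPo ysum).
Proof.
(* [tau] fixes the y_ji and sends x_i to the sum of the y_ji. It kills the linear generators and
   sends the others to elements f(y_j), which are combinations of binomials with equal weights. *)
pose tau : (n + r * n).-tuple {mpoly K[r * n]} :=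
  [tuple match split k with inl i => tnth ysum i | inr l => 'X_l end | k < n + r * n].
have tau_x i : xvar K r i \mPo tau = tnth ysum i.
  rewrite /xvar comp_mpolyXU -tnth_nth tnth_mktuple.
  by case: split_ordP => [i' /lshift_inj -> //|j /eqP]; rewrite eq_lrshift.
have tau_y j i : yvar K j i \mPo tau = 'X_(mxvec_index j i).
  rewrite /yvar comp_mpolyXU -tnth_nth tnth_mktuple.
  by case: split_ordP => [i' /eqP|l /rshift_inj -> //]; rewrite eq_rlshift.
move=> [s sgen]; move=> /(congr1 (comp_mpoly tau)).
rewrite comp_mpoly_comp (_ : [tuple _ | _ < _] = ysum); last first.
  by apply: eq_from_tnth => i; rewrite !tnth_mktuple tau_x tnth_mktuple.
move=> -> c; rewrite comp_mpoly_sum raddf_sum big_seq big1 // => q qs /=.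
rewrite comp_mpolyM.
apply: (@fibre_null_mull _ _ _ _ (q.2 \mPo tau) (q.1 \mPo tau) secant_weightD).
have [[j [f If ->]]|[i ->]] := sgen q qs; last first.
  move=> e; rewrite comp_mpolyB comp_mpoly_sum /= tau_x tnth_mktuple.
  by rewrite (eq_bigr _ (fun j _ => tau_y j i)) subrr raddf0.
rewrite comp_mpoly_comp
  (_ : [tuple _ | _ < _] = [tuple 'X_(mxvec_index j i) | i < n]); last first.
  by apply: eq_from_tnth => i; rewrite !tnth_mktuple tau_y.
move=> e; have [rep repP ->] := fibre_null_sub_rep (toric_fibre_null If).
rewrite comp_mpoly_sum raddf_sum big_seq big1 // => m mf /=.
rewrite comp_mpolyZ comp_mpolyB linearZ raddfB /= !comp_mpolyX_ylift !fibre_sumX.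
rewrite (_ : secant_weight _ = secant_weight (ylift j (rep m))) ?subrr ?mulr0 //.
have [_ wrep] := repP m mf.
by apply/ffunP => j'; rewrite !ffunE !yblock_ylift; case: eqP; rewrite ?wrep.
Qed.

(** Modulo the generators, p(x) is p(y_1 + ... + y_r), a combination of binomials in which both
    monomials have toric binomials as the differences of their y_j-parts. The free choice of [w]
    admits an encoding of the weights in a finite set. *)
Lemma secant_of_fibre_null (T : eqType) (w : 'X_{1..r * n} -> T) p :
    {in msupp (p \mPo ysum) &,
      forall v1 v2, w v1 = w v2 -> secant_weight v1 = secant_weight v2} ->
    fibre_null w (p \mPo ysum) ->
  secant_ideal r (toric_ideal K A) p.
Proof.
move=> w_fine p0; rewrite /secant_ideal.
set J := secant_generator _.
pose yvars : (r * n).-tuple {mpoly K[n + r * n]} := [tuple 'X_(rshift n k) | k < r * n].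
rewrite -[_ \mPo _](subrK ((p \mPo ysum) \mPo yvars)); apply: ideal_genD.
  rewrite comp_mpoly_comp; apply: ideal_gen_sub_comp => i.
  rewrite -opprB; apply: ideal_genN; apply: mem_ideal_gen; right; exists i.
  rewrite !tnth_mktuple comp_mpoly_sum; congr (_ - _); apply: eq_bigr => j _.
  by rewrite /= comp_mpolyXU -tnth_nth tnth_mktuple.
have [rep repP ->] := fibre_null_sub_rep p0.
rewrite comp_mpoly_sum big_seq; apply: ideal_gen_sum => v vp /=.
rewrite comp_mpolyZ -mul_mpolyC; apply: ideal_genM.
have yvarsE u : 'X_[u] \mPo yvars =
    \prod_(j < r) ('X_[yblock j u] \mPo [tuple yvar K j i | i < n]).
  rewrite comp_mpolyX big_mxvec_index; apply: eq_bigr => j _.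
  by rewrite comp_mpolyX; apply: eq_bigr => i _; rewrite !tnth_mktuple mnmE.
rewrite comp_mpolyB !yvarsE; apply: ideal_gen_sub_prod => j _.
rewrite -comp_mpolyB; apply: mem_ideal_gen; left; exists j.
exists ('X_[yblock j v] - 'X_[yblock j (rep v)]) => //.
apply: toric_binomial; have [repv wrep] := repP v vp.
by have /ffunP/(_ j) := w_fine _ _ vp repv (esym wrep); rewrite !ffunE.
Qed.

End SecantToric.

(** * Standard monomials *)

Definition decide (P : Prop) : bool :=
  if excluded_middle_informative P then true else false.

Lemma decideP P : reflect P (decide P).
Proof. by rewrite /decide; case: excluded_middle_informative => ?; constructor. Qed.

Lemma total_seq_max (T : eqType) (le : rel T) (s : seq T) :
  total le -> transitive le -> s != [::] ->
  exists2 m, m \in s & forall m', m' \in s -> le m' m.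
Proof.
move=> le_total le_trans; have le_refl m : le m m by have := le_total m m; rewrite orbb.
elim: s => // m s IHs _; have [->|/IHs[m0 m0s maxm0]] := eqVneq s [::].
  by exists m => [|m']; rewrite ?mem_head // inE => /eqP->.
have [lem|lem] := orP (le_total m m0).
  exists m0 => [|m']; rewrite inE ?m0s ?orbT // => /predU1P[->//|].
  exact: maxm0.
exists m => [|m']; rewrite ?mem_head // inE => /predU1P[->//|/maxm0 le'].
exact: le_trans lem.
Qed.

Section StandardMonomials.
Variables (K : fieldType) (n : nat) (le : rel 'X_{1..n}).
Hypothesis le_order : term_order le.

Lemma exists_leading_monomial (p : {mpoly K[n]}) : p != 0 ->
  exists m, leading_monomial le p m.
Proof.
have [le_total le_trans _ _ _] := le_order.
by rewrite -msupp_eq0 => /(total_seq_max le_total le_trans)[m]; exists m.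
Qed.

Lemma leading_monomialMX (p : {mpoly K[n]}) m m' : leading_monomial le p m ->
  leading_monomial le (p * 'X_[m']) (m + m')%MM.
Proof.
have [_ _ _ _ leD] := le_order.
move=> [mp maxm]; split; first by rewrite (perm_mem (msuppMX _ _)) addmC map_f.
move=> u; rewrite (perm_mem (msuppMX _ _)) => /mapP[v vp ->].
by rewrite addmC; apply: leD; apply: maxm.
Qed.

Variable I : {mpoly K[n]} -> Prop.
Hypothesis I0 : I 0.
Hypothesis ID : forall p q, I p -> I q -> I (p + q).
Hypothesis IM : forall p q, I q -> I (p * q).

Let IZ c p : I p -> I (c *: p).
Proof. by move=> Ip; rewrite -mul_mpolyC; apply: IM. Qed.

(* The witness has to be homogeneous, so that the standard monomials compute the
   Hilbert function even if I is not assumed to be homogeneous. *)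
Definition nonstandard (m : 'X_{1..n}) : Prop :=
  exists p, [/\ I p, p \is (mdeg m).-homog & leading_monomial le p m].

Lemma nonstandardD m m' : nonstandard m -> nonstandard (m + m')%MM.
Proof.
move=> [p [Ip hp lmp]]; exists (p * 'X_[m']); split.
- by rewrite mulrC; apply: IM.
- by rewrite mdegD; apply: dhomogM; rewrite // dhomogX.
- exact: leading_monomialMX.
Qed.

Definition monomial_of (s : seq nat) : 'X_{1..n} := [multinom nth 0%N s i | i < n].

Lemma monomial_ofK (m : 'X_{1..n}) : monomial_of m = m.
Proof. by apply/mnmP => i; rewrite mnmE [RHS](mnm_nth 0%N). Qed.

Lemma monomial_of_inj m : {in compositions n m &, injective monomial_of}.
Proof.
move=> s t; rewrite !mem_compositions => /andP[/eqP szs _] /andP[/eqP szt _] eqst.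
apply: (@eq_from_nth _ 0%N) => [|i]; first by rewrite szs szt.
by rewrite szs => lti; have /mnmP/(_ (Ordinal lti)) := eqst; rewrite !mnmE.
Qed.

Lemma mdeg_monomial_of m s : s \in compositions n m -> mdeg (monomial_of s) = m.
Proof.
rewrite mem_compositions => /andP[/eqP szs /eqP <-].
rewrite mdegE sumnE (big_nth 0%N) szs big_mkord.
by apply: eq_bigr => i _; rewrite mnmE.
Qed.

Definition nonstandardb (s : seq nat) : bool := decide (nonstandard (monomial_of s)).

Lemma nonstandardP s : reflect (nonstandard (monomial_of s)) (nonstandardb s).
Proof. exact: decideP. Qed.

Lemma nonstandardb_upset : is_upset nonstandardb.
Proof.
move=> s t lest /nonstandardP ns; apply/nonstandardP.
rewrite -(submK (m := monomial_of s) (m' := monomial_of t)).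
  by rewrite addmC; apply: nonstandardD.
apply/mnm_lepP => i; rewrite !mnmE; move: lest; rewrite all2E => /andP[/eqP szst].
move/(all_nthP (0, 0)%N) => /(_ i); rewrite size_zip szst minnn nth_zip //=.
by have [lti /(_ isT)|lti _] := ltnP i (size t); last by rewrite nth_default ?szst.
Qed.

(** Macaulay's theorem: the standard monomials of degree m form a basis modulo [I]. A nonzero
    combination of them has a standard leading monomial, so it is not in [I]; they span by repeated
    replacement of nonstandard monomials by smaller ones. *)
Lemma standard_hilbert_function m :
  hilbert_function_at I m (count (predC nonstandardb) (compositions n m)).
Proof.
pose S := [seq monomial_of s | s <- compositions n m & ~~ nonstandardb s].
have szS : size S = count (predC nonstandardb) (compositions n m).
  by rewrite size_map size_filter.
have memS u : u \in S <-> mdeg u = m /\ ~ nonstandard u.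
  split=> [/mapP[s] | [degu stdu]].
    rewrite mem_filter => /andP[/nonstandardP nss sm] ->.
    by rewrite (mdeg_monomial_of sm).
  apply/mapP; exists (u : seq nat); last by rewrite monomial_ofK.
  rewrite mem_filter mem_compositions size_tuple eqxx sumnE -/(mdeg u) degu eqxx.
  by rewrite !andbT; apply/nonstandardP; rewrite monomial_ofK.
have uniqS : uniq S.
  rewrite map_inj_in_uniq ?filter_uniq ?compositions_uniq // => s t.
  by rewrite !mem_filter => /andP[_ sm] /andP[_ tm]; apply: (@monomial_of_inj m).
rewrite -szS; pose b (i : 'I_(size S)) : {mpoly K[n]} := 'X_[nth 0%MM S i].
have coefb (c : 'I_(size S) -> K) (i : 'I_(size S)) :
    (\sum_j c j *: b j)@_(nth 0%MM S i) = c i.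
  rewrite raddf_sum (bigD1 i) //= mcoeffZ mcoeffX eqxx mulr1 big1 ?addr0 // => j neji.
  by rewrite mcoeffZ mcoeffX nth_uniq // (inj_eq val_inj) (negPf neji) mulr0.
have homb i : b i \is m.-homog.
  by rewrite dhomogX; have /memS[Em _] := mem_nth 0%MM (ltn_ord i); apply/eqP.
have suppb (c : 'I_(size S) -> K) u : u \in msupp (\sum_j c j *: b j) -> u \in S.
  apply: contraTT => nuS; rewrite mcoeff_msupp negbK raddf_sum big1 //= => j _.
  rewrite mcoeffZ mcoeffX; case: eqP => [E|_]; last by rewrite mulr0.
  by case/negP: nuS; rewrite -E mem_nth.
exists b; split=> // [c Ic i|].
  apply/eqP/negPn/negP => ci; have nz : \sum_j c j *: b j != 0.
    by apply: contraNneq ci => E; rewrite -(coefb c i) E mcoeff0.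
  have [u lmu] := exists_leading_monomial nz.
  have /memS[degu []] := suppb c u (proj1 lmu).
  exists (\sum_j c j *: b j); split=> //; rewrite degu.
  by apply: rpred_sum => j _; apply: dhomogZ.
pose red q := exists c : 'I_(size S) -> K, I (q - \sum_i c i *: b i).
have redI q : I q -> red q.
  by exists (fun=> 0); rewrite big1 ?subr0 // => i _; rewrite scale0r.
have redD q1 q2 : red q1 -> red q2 -> red (q1 + q2).
  move=> [c1 I1] [c2 I2]; exists (fun i => c1 i + c2 i).
  under eq_bigr do rewrite scalerDl.
  by rewrite big_split opprD addrACA; apply: ID.
have redZ a q : red q -> red (a *: q).
  move=> [c Ic]; exists (fun i => a * c i).
  under eq_bigr do rewrite -scalerA.
  by rewrite -scaler_sumr -scalerBr; apply: IZ.
have red_sum (r : seq 'X_{1..n}) (P : pred _) (F : 'X_{1..n} -> {mpoly K[n]}) :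
    {in r, forall u, P u -> red (F u)} -> red (\sum_(u <- r | P u) F u).
  move=> redF; rewrite big_seq_cond; elim/big_rec: _; first exact: redI.
  by move=> u x /andP[ur Pu]; apply: redD; apply: redF.
suff redX u : mdeg u = m -> red 'X_[u].
  move=> p hp; rewrite -/(red p) [p]mpolyE; apply: red_sum => u up _; apply: redZ.
  by apply: redX; apply: (dhomog_mf hp).
have [le_total le_trans le_anti _ _] := le_order.
(* The replacement stays in degree m, so the finite number of monomials of degree at most m strictly
   below [u] measures its progress. *)
pose below u := [pred v : 'X_{1..n < m.+1} | le v u && (v != u :> 'X_{1..n})].
have [k] := ubnP #|below u|; elim: k u => // k IHk u ltk degu.
have [[p [Ip hp [up maxu]]]|stdu] := classic (nonstandard u); last first.
  have uS : u \in S by apply/memS.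
  have ltu : (index u S < size S)%N by rewrite index_mem.
  exists (fun i => (i == Ordinal ltu)%:R); rewrite (bigD1 (Ordinal ltu)) //= eqxx scale1r.
  rewrite big1 ?addr0 /b /= ?nth_index ?subrr // => i /negPf->.
  by rewrite scale0r.
have pu0 : p@_u != 0 by rewrite -mcoeff_msupp.
have -> : 'X_[u] = (p@_u)^-1 *: p + (- (p@_u)^-1) *:
    \sum_(v <- msupp p | v != u) p@_v *: 'X_[v].
  rewrite {2}[p]mpolyE (bigD1_seq u) ?msupp_uniq //= scalerDr scalerA mulVf //.
  by rewrite scale1r scaleNr addrK.
apply: redD; first exact/redI/IZ.
apply: (redZ); apply: red_sum => v vp nevu; apply: (redZ).
have degv : mdeg v = m by rewrite (dhomog_mf hp vp) degu.
rewrite ltnS in ltk; apply: IHk => //; apply: leq_trans ltk; apply: proper_card.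
have ltv : (mdeg v < m.+1)%N by rewrite degv.
apply/properP; split.
  apply/subsetP => w /andP[lewv newv]; rewrite inE (le_trans _ _ _ lewv) ?maxu //=.
  apply: contraNneq newv => wu; move: lewv; rewrite wu => leuv.
  by rewrite (le_anti u v) // leuv maxu.
exists (BMultinom ltv); rewrite !inE /= ?eqxx ?andbF // maxu //.
Qed.

End StandardMonomials.

(** * Facets of a regular triangulation *)

Lemma mulmx_kernel_neq0 (F : fieldType) m n (B : 'M[F]_(m, n)) : (n < m)%N ->
  exists2 u : 'rV[F]_m, u != 0 & u *m B = 0.
Proof.
move=> ltnm; have : kermx B != 0.
  rewrite -mxrank_eq0 mxrank_ker subn_eq0 -ltnNge.
  exact: leq_ltn_trans (rank_leq_col B) ltnm.
by case/rowV0Pn=> u /sub_kermxP uB u0; exists u.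
Qed.

Lemma common_denominator n (c : 'I_n -> rat) : exists (D : int) (z : 'I_n -> int),
  D != 0 /\ forall i, (z i)%:~R = D%:~R * c i.
Proof.
exists (\prod_j denq (c j)), (fun i => numq (c i) * \prod_(j | j != i) denq (c j)).
split=> [|i]; first by apply/prodf_neq0 => j _; rewrite denq_neq0.
by rewrite [in RHS](bigD1 i) //= !intrM numqE; ring.
Qed.

Section ToricInitial.
Variables (K : fieldType) (d n : nat) (A : 'M[int]_(d, n)) (le : rel 'X_{1..n}).
Hypothesis le_order : term_order le.
Local Notation I := (toric_ideal K A).
Local Notation weight := (toric_weight A).

Lemma toric_idealM p q : I q -> I (p * q).
Proof.
rewrite /toric_ideal -[fun c => _]/(@tofrac {mpoly K[d]} \o @mpolyC d K) => Iq.
by rewrite (rmorphM (mmap _ _)) /= Iq mulr0.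
Qed.

Lemma weight_linear (l : 'I_d -> rat) m :
  \sum_k l k * (weight m k 0)%:~R = \sum_i (m i)%:R * (\sum_k l k * (A k i)%:~R).
Proof.
under [RHS]eq_bigr do rewrite mulr_sumr.
rewrite exchange_big; apply: eq_bigr => k _ /=.
rewrite toric_weightE rmorph_sum mulr_sumr; apply: eq_bigr => i _ /=.
by rewrite rmorphMn /= mulrnAr mulr_natl.
Qed.

Definition set_mnm (S : {set 'I_n}) (k : nat) : 'X_{1..n} :=
  [multinom if i \in S then k else 0%N | i < n].

Lemma prod_set_mnm (S : {set _}) k :
  (\prod_(i in S) 'X_i) ^+ k = 'X_[set_mnm S k] :> {mpoly K[n]}.
Proof.
rewrite mpolyXE_id -prodrXl big_mkcond; apply: eq_bigr => i _.
by rewrite mnmE; case: ifP.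
Qed.

Lemma binomial_leading m1 m2 : le m2 m1 -> m1 != m2 ->
  leading_monomial le ('X_[m1] - 'X_[m2] : {mpoly K[n]}) m1.
Proof.
have [le_total _ _ _ _] := le_order.
move=> le21 ne12; split=> [|m /msuppB_le].
  by rewrite mcoeff_msupp mcoeffB !mcoeffX eqxx (eq_sym m2) (negPf ne12) subr0 oner_neq0.
rewrite mem_cat !msuppX !inE => /orP[] /eqP-> //.
by have := le_total m1 m1; rewrite orbb.
Qed.

(** A monomial occurring in a combination of leading monomials is a multiple of one of them, and
    multiples of leading monomials are leading. *)
Lemma initial_ideal_leading u : initial_ideal le I ('X_[u] : {mpoly K[n]}) ->
  exists p, I p /\ leading_monomial le p u.
Proof.
move=> [s sI E]; have : u \in msupp ('X_[u] : {mpoly K[n]}) by rewrite msuppX mem_head.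
rewrite [X in msupp X]E => /msupp_sum_le/flatten_mapP[q]; rewrite mem_filter /= => qs.
have [p [m [Ip lmp ->]]] := sI q qs.
rewrite (perm_mem (msuppMX _ _)) => /mapP[m' _ ->].
exists (p * 'X_[m']); split; first by rewrite mulrC; apply: toric_idealM.
exact: leading_monomialMX.
Qed.

Variable Delta : {set {set 'I_n}}.
Hypothesis DeltaP : forall S : {set 'I_n}, S \in Delta <->
  forall k : nat, ~ initial_ideal le I ((\prod_(i in S) 'X_i) ^+ k).

(** A monomial supported on [S] divides the power of exponent [mdeg m] of the product of the
    variables in [S]. *)
Lemma face_not_leading S (m : 'X_{1..n}) (p : {mpoly K[n]}) : S \in Delta ->
  (forall i, m i != 0%N -> i \in S) -> I p -> ~ leading_monomial le p m.
Proof.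
move=> /DeltaP SD mS Ip lmp; apply: (SD (mdeg m)); rewrite prod_set_mnm.
have lem : (m <= set_mnm S (mdeg m))%MM.
  apply/mnm_lepP => i; rewrite mnmE; case: ifPn => [_|iS].
    by rewrite mdegE (bigD1 i) //= leq_addr.
  by rewrite leqn0; apply: contraNT iS; apply: mS.
rewrite -(submK lem) mpolyXD; apply: ideal_genM; apply: mem_ideal_gen.
by exists p, m.
Qed.

(** More than d columns are linearly dependent. The positive and negative parts of an integral
    relation form a toric binomial supported on [S], and one of its two monomials is leading. *)
Lemma card_face_le S : S \in Delta -> (#|S| <= d)%N.
Proof.
move=> SD; rewrite leqNgt; apply/negP => ltdS.
(* The left block expresses that u is a relation between the columns of [A], the right block that u
   vanishes off [S]. *)
pose B : 'M[rat]_(n, d + #|~: S|) :=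
  row_mx (map_mx intr A)^T (\matrix_(i, k) (i == enum_val k)%:R).
have [|u u0] := mulmx_kernel_neq0 B.
  by have := cardsC S; rewrite card_ord; lia.
rewrite mul_mx_row -[0 in X in X -> _]row_mx0 => /eq_row_mx[uA uS].
have [D [z [D0 zE]]] := common_denominator (u 0).
have zS i : i \notin S -> z i = 0.
  move=> iS; have iC : i \in ~: S by rewrite inE.
  apply/eqP; rewrite -(intr_eq0 rat) zE; apply/eqP.
  have /rowP/(_ (enum_rank_in iC i)) := uS; rewrite !mxE (bigD1 i) //= mxE enum_rankK_in //.
  rewrite eqxx mulr1 big1 ?addr0 => [->|j nej]; first by rewrite mulr0.
  by rewrite mxE enum_rankK_in // (negPf nej) mulr0.
pose m1 : 'X_{1..n} := [multinom if (0 <= z i)%R then absz (z i) else 0%N | i < n].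
pose m2 : 'X_{1..n} := [multinom if (0 <= z i)%R then 0%N else absz (z i) | i < n].
have m12 i : z i = (m1 i)%:Z - (m2 i)%:Z by rewrite !mnmE; case: ifP; lia.
have wE : weight m1 = weight m2.
  apply/colP => k; apply/eqP; rewrite !toric_weightE -subr_eq0 -sumrB.
  rewrite -(intr_eq0 rat) rmorph_sum /=.
  have /rowP/(_ k) := uA; rewrite !mxE => /(congr1 ( *%R D%:~R)).
  rewrite mulr0 mulr_sumr => /eqP; congr (_ == _); apply: eq_bigr => i _.
  have -> : A k i *+ m1 i - A k i *+ m2 i = A k i * z i.
    by rewrite m12 mulrBr -!(mulr_natr (A k i)) !natz.
  by rewrite !mxE mulrA -zE intrM mulrC.
have nz : m1 != m2.
  apply: contraNneq u0 => E; apply/eqP/rowP => i; rewrite !mxE.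
  have : (z i)%:~R = 0 :> rat by rewrite m12 E subrr.
  by rewrite zE => /eqP; rewrite mulf_eq0 intr_eq0 (negPf D0) => /eqP.
have [le_total _ _ _ _] := le_order.
have m1S i : m1 i != 0%N -> i \in S.
  by apply: contraNT => /zS zi; rewrite mnmE zi.
have m2S i : m2 i != 0%N -> i \in S.
  by apply: contraNT => /zS zi; rewrite mnmE zi.
have [le12|le21] := orP (le_total m1 m2).
  apply: (face_not_leading SD m2S (toric_binomial K (esym wE))).
  by apply: binomial_leading; rewrite // eq_sym.
apply: (face_not_leading SD m1S (toric_binomial K wE)).
exact: binomial_leading.
Qed.

Hypothesis A_graded : exists w : 'cV[rat]_d,
  forall j : 'I_n, (w^T *m col j (map_mx intr A)) 0 0 = 1.

Lemma weight_mdeg m1 m2 : weight m1 = weight m2 -> mdeg m1 = mdeg m2.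
Proof.
have [w wP] := A_graded; move=> E.
have degE m : (mdeg m)%:R = \sum_k w k 0 * (weight m k 0)%:~R :> rat.
  rewrite (weight_linear (fun k => w k 0)) mdegE natr_sum; apply: eq_bigr => i _.
  rewrite -[LHS]mulr1; congr (_ * _); apply: etrans (esym (wP i)) _.
  by rewrite mxE; apply: eq_bigr => k _; rewrite !mxE.
by apply/eqP; rewrite -(eqr_nat rat) !degE E.
Qed.

(** The grading confines a fibre to one degree, so it is finite. *)
Lemma exists_fibre_min m : exists u, weight u = weight m /\
  forall v, weight v = weight m -> le u v.
Proof.
have [le_total le_trans _ _ _] := le_order.
pose s := [seq u <- [seq bmnm v | v : 'X_{1..n < (mdeg m).+1}] | weight u == weight m].
have memS u : weight u = weight m -> u \in s.
  move=> E; rewrite mem_filter E eqxx /=; apply/mapP.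
  have ltu : (mdeg u < (mdeg m).+1)%N by rewrite (weight_mdeg E).
  by exists (BMultinom ltu); rewrite ?mem_enum.
have [|||u us umin] := @total_seq_max _ (fun x y => le y x) s.
- by move=> x y; apply: le_total.
- by move=> x y z xy yz; apply: le_trans yz xy.
- by apply/eqP => s0; have := memS m erefl; rewrite s0.
exists u; split; first by move: us; rewrite mem_filter => /andP[/eqP].
by move=> v /memS/umin.
Qed.

(** Exponents of [p] in the fibre of a leading [u] would be both at most and at least [u], so the
    fibre sum would be the nonzero coefficient of [u]. *)
Lemma fibre_min_not_leading u (p : {mpoly K[n]}) :
  (forall v, weight v = weight u -> le u v) -> I p -> ~ leading_monomial le p u.
Proof.
have [_ _ le_anti _ _] := le_order.
move=> umin Ip [up umax]; have := toric_fibre_null Ip (weight u).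
rewrite /fibre_sum big_mkcond (bigD1_seq u) ?msupp_uniq //= eqxx big_seq_cond.
rewrite big1 => [/eqP|v].
  by rewrite addr0 -[_ == _]negbK -mcoeff_msupp up.
move=> /andP[vp /eqP nevu]; case: eqP => // wv; case: nevu; apply: le_anti.
by rewrite umax // umin.
Qed.

Hypothesis A_rank : \rank (map_mx intr A : 'M[rat]_(d, n)) = d.

Lemma card_facet S : S \in facets Delta -> #|S| = d.
Proof.
rewrite inE => /maxsetP[SD Smax]; rewrite inE in SD.
apply/eqP; rewrite eqn_leq card_face_le //= leqNgt; apply/negP => ltSd.
have [_ _ le_anti _ leD] := le_order; have [le_total _ _ _ _] := le_order.
pose B : 'M[rat]_(d, #|S|) := \matrix_(k, i) (A k (enum_val i))%:~R.
have [l l0 lB] := mulmx_kernel_neq0 B ltSd.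
pose L i : rat := \sum_k l 0 k * (A k i)%:~R.
have LS i : i \in S -> L i = 0.
  move=> iS; have /rowP/(_ (enum_rank_in iS i)) := lB; rewrite !mxE => <-.
  by apply: eq_bigr => k _; rewrite mxE enum_rankK_in.
have [j Lj] : exists j, L j != 0.
  apply: NNPP => noL; case/negP: l0.
  rewrite -(mulmx_free_eq0 _ (_ : row_free (map_mx intr A : 'M[rat]_(d, n)))).
    apply/eqP/rowP => j; rewrite !mxE; apply: NNPP => Lj; apply: noL.
    exists j; apply/eqP => Lj0; apply: Lj.
    by apply: etrans Lj0; apply: eq_bigr => k _; rewrite ?mxE.
  by rewrite /row_free A_rank.
(* By maximality, [S] with one more vertex is not a face. *)
have : forall i, exists k, i \notin S ->
    initial_ideal le I ((\prod_(i' in i |: S) 'X_i') ^+ k).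
  move=> i; have [iS|iS] := boolP (i \in S); first by exists 0%N.
  apply: NNPP => noi; have : i |: S \in Delta.
    by apply/DeltaP => k Ik; apply: noi; exists k.
  by move=> iSD; case/negP: iS; rewrite -(Smax _ iSD (subsetUr _ _)) setU11.
move=> /choice[kf kfP]; pose k := (\sum_i kf i)%N.
(* This makes [N] times |L j| exceed every value of the form [L] on exponents that are at most [k]
   off [S]. *)
pose N := Num.bound ((k%:R * \sum_i `|L i|) / `|L j|).
pose start t := (set_mnm S t + U_(j) *+ N)%MM.
have [u uP] := choice _ (fun t => exists_fibre_min (start t)).
have [g g_mono gP] := dickson_subseq n (fun t => nth 0%N (u t)).
have weightE t1 t2 : (t1 <= t2)%N ->
    weight (u t2) = weight (set_mnm S (t2 - t1) + u t1)%MM.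
  move=> le12; rewrite toric_weightD !(proj1 (uP _)) -toric_weightD; congr weight.
  by apply/mnmP => i; rewrite !mnmE; case: ifP => _; lia.
have growing a s : s \in S -> (u (g a) s < u (g a.+1) s)%N.
  move=> sS; have lta : (g a < g a.+1)%N by exact: g_mono.
  have leu : (u (g a) <= u (g a.+1))%MM.
    by apply/mnm_lepP => i; rewrite !(mnm_nth 0%N); apply: gP.
  rewrite ltn_neqAle (mnm_lepP leu) andbT; apply/negP => /eqP eqs.
  (* Otherwise v and the standard exponent c, of equal weights, differ at s; so
     c < v, and c + u (g a) lies below the fibre minimum u (g a.+1). *)
  pose v := (u (g a.+1) - u (g a))%MM; pose c := set_mnm S (g a.+1 - g a).
  have vK : (v + u (g a))%MM = u (g a.+1) by exact: submK.
  have wE : weight c = weight v.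
    apply: (addIr (weight (u (g a)))); rewrite -!toric_weightD vK.
    by rewrite -weightE // ltnW.
  have cv : c != v.
    apply/eqP => /mnmP/(_ s); rewrite !mnmE sS -eqs; lia.
  have [lecv|levc] := orP (le_total c v); last first.
    apply: (face_not_leading SD _ (toric_binomial K wE) (binomial_leading levc cv)).
    by move=> i; rewrite mnmE; case: ifP.
  case/eqP: cv; apply: (@addIm _ (u (g a))); apply: le_anti.
  rewrite leD // vK; apply: (proj2 (uP _)).
  by rewrite -[RHS](proj1 (uP (g a.+1))) (weightE (g a)) // ltnW.
have largeS a s : s \in S -> (a <= u (g a) s)%N.
  by move=> sS; elim: a => // a IHa; apply: leq_ltn_trans IHa (growing _ _ sS).
(* [u (g k)] is at least [k] on [S]. If it were so at [i] too, it would be divisible by a monomial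
   of the initial ideal, which a fibre minimum is not. *)
have smallC i : i \notin S -> (u (g k) i < k)%N.
  move=> iS; rewrite ltnNge; apply/negP => leki.
  have := kfP i iS; rewrite prod_set_mnm => /initial_ideal_leading[p [Ip lmp]].
  have lekf : (kf i <= k)%N by rewrite /k (bigD1 i) //= leq_addr.
  have le_u : (set_mnm (i |: S) (kf i) <= u (g k))%MM.
    apply/mnm_lepP => i'; rewrite mnmE; case: ifP => // /setU1P[->|i'S].
      exact: leq_trans leki.
    exact: leq_trans (largeS _ _ i'S).
  apply: (@fibre_min_not_leading (u (g k)) (p * 'X_[u (g k) - set_mnm (i |: S) (kf i)])).
  - by move=> v; rewrite (proj1 (uP _)); apply: (proj2 (uP _)).
  - by rewrite mulrC; apply: toric_idealM.
  - by rewrite -[X in leading_monomial _ _ X](submK le_u) addmC; apply: leading_monomialMX.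
(* The form depends only on the weight, so it may be evaluated at [start (g k)], where [S]
   contributes 0. *)
have linE : \sum_i (u (g k) i)%:R * L i = N%:R * L j.
  rewrite -(weight_linear (l 0)) (proj1 (uP _)) (weight_linear (l 0)) (bigD1 j) //=.
  rewrite [X in _ + X]big1 ?addr0 => [|i nej];
    rewrite -/(L _) /start mnmDE mulmnE mnm1E mnmE.
    have /negPf-> : j \notin S by apply: contraNN Lj => /LS->.
    by rewrite eqxx mul1n.
  rewrite eq_sym (negPf nej) mul0n addn0.
  by case: ifP => [iS|_]; rewrite ?mul0r // LS ?mulr0.
have Lj_gt0 : 0 < `|L j| by rewrite normr_gt0.
have : `|N%:R * L j| <= k%:R * \sum_i `|L i|.
  rewrite -linE mulr_sumr; apply: le_trans (ler_norm_sum _ _ _) _.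
  apply: ler_sum => i _; rewrite normrM normr_nat.
  have [iS|iS] := boolP (i \in S); first by rewrite LS // normr0 !mulr0.
  by apply: ler_wpM2r => //; rewrite ler_nat ltnW // smallC.
rewrite normrM normr_nat -ler_pdivlMr // leNgt => /negP[].
by apply: archi_boundP; rewrite divr_ge0 ?mulr_ge0 ?sumr_ge0.
Qed.

End ToricInitial.

(** * Bounds for the Hilbert function of a secant ideal *)

Section Blocks.
Variables (K : fieldType) (n r : nat).
Local Notation ysum := (@ysum K n r).

Lemma sum_yblockE (v : 'X_{1..r * n}) i :
  (\sum_(j < r) yblock j v)%MM i = (\sum_(j < r) v (mxvec_index j i))%N.
Proof. by rewrite mnm_sumE; apply: eq_bigr => j _; rewrite mnmE. Qed.

Lemma sum_yblockD (v1 v2 : 'X_{1..r * n}) :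
  (\sum_(j < r) yblock j (v1 + v2))%MM =
  (\sum_(j < r) yblock j v1 + \sum_(j < r) yblock j v2)%MM.
Proof.
apply/mnmP => i; rewrite mnmDE !sum_yblockE -big_split.
by apply: eq_bigr => j _; rewrite mnmDE.
Qed.

Lemma mdeg_yblock (v : 'X_{1..r * n}) : mdeg v = (\sum_(j < r) mdeg (yblock j v))%N.
Proof.
rewrite mdegE big_mxvec_index.
by apply: eq_bigr => j _; rewrite mdegE; apply: eq_bigr => i _; rewrite mnmE.
Qed.

Lemma msupp_compX_ysum u v :
  v \in msupp ('X_[u] \mPo ysum) -> (\sum_(j < r) yblock j v)%MM = u.
Proof.
(* This property is multiplicative in [q] and additive in [u], which reduces the claim to single
   variables. *)
pose blocked (q : {mpoly K[r * n]}) u :=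
  forall v, v \in msupp q -> (\sum_(j < r) yblock j v)%MM = u.
have blocked1 : blocked 1 0%MM.
  move=> v'; rewrite msupp1 inE => /eqP->; apply/mnmP => i.
  by rewrite sum_yblockE mnm0E big1 // => j _; rewrite mnm0E.
have blockedM q1 u1 q2 u2 : blocked q1 u1 -> blocked q2 u2 ->
    blocked (q1 * q2) (u1 + u2)%MM.
  move=> b1 b2 v' /msuppM_le/allpairsP[[v1 v2] /= [/b1 <- /b2 <- ->]].
  exact: sum_yblockD.
suff: blocked ('X_[u] \mPo ysum) u by apply.
rewrite comp_mpolyX [X in blocked _ X]multinomUE_id.
elim/big_ind2: _ => // i _; elim: (u i) => [//|e IHe].
rewrite exprS mulmS; apply: blockedM => // v'; rewrite tnth_mktuple.
move=> /msupp_sum_le/flatten_mapP[j _]; rewrite msuppX inE => /eqP->.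
apply/mnmP => i'; rewrite sum_yblockE mnm1E (bigD1 j) //= mnm1E.
rewrite big1 ?addn0 => [|j' nej]; rewrite ?mnm1E eq_mxvec_index ?eqxx //.
by rewrite eq_sym (negPf nej).
Qed.

Lemma msupp_comp_ysum (p : {mpoly K[n]}) v :
  v \in msupp (p \mPo ysum) -> (\sum_(j < r) yblock j v)%MM \in msupp p.
Proof.
rewrite comp_mpolyEX => /msupp_sum_le/flatten_mapP[u]; rewrite mem_filter /= => up.
move=> vu; have : v \in msupp ('X_[u] \mPo ysum).
  by move: vu; rewrite !mcoeff_msupp mcoeffZ mulf_eq0 negb_or => /andP[].
by move/msupp_compX_ysum => ->.
Qed.

Lemma comp_ysum_homog m (p : {mpoly K[n]}) : p \is m.-homog ->
  {in msupp (p \mPo ysum), forall v, mdeg v = m}.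
Proof.
move=> hp v /msupp_comp_ysum vp; rewrite mdeg_yblock -mdeg_sum.
exact: (dhomog_mf hp).
Qed.

Variable jf : 'I_n -> 'I_r.

(** The whole power of x_i goes to the block [jf i]. When [jf i] is the index of the face containing
    i, the blocks are the restrictions of [u] to the faces. *)
Definition block_lift (u : 'X_{1..n}) : 'X_{1..r * n} :=
  [multinom if jf (mxvec_pair k).2 == (mxvec_pair k).1 then u (mxvec_pair k).2
            else 0%N | k < r * n].

Lemma yblock_lift j u i :
  yblock j (block_lift u) i = if jf i == j then u i else 0%N.
Proof. by rewrite !mnmE mxvec_indexK. Qed.

Lemma sum_yblock_lift u : (\sum_(j < r) yblock j (block_lift u))%MM = u.
Proof.
apply/mnmP => i; rewrite mnm_sumE (bigD1 (jf i)) //= yblock_lift eqxx.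
rewrite big1 ?addn0 // => j nej; rewrite yblock_lift eq_sym.
by rewrite (negPf nej).
Qed.

(* Setting y_(j,i) to x_i if j = jf i and to 0 otherwise is a left inverse of
   x_i |-> sum_j y_(j,i) that leaves the lifted monomials apart. *)
Lemma mcoeff_block_lift (p : {mpoly K[n]}) u : (p \mPo ysum)@_(block_lift u) = p@_u.
Proof.
pose tau : (r * n).-tuple {mpoly K[n]} :=
  [tuple if jf (mxvec_pair k).2 == (mxvec_pair k).1 then 'X_(mxvec_pair k).2 else 0
    | k < r * n].
have tauE j i : tnth tau (mxvec_index j i) = if jf i == j then 'X_i else 0.
  by rewrite tnth_mktuple mxvec_indexK.
have pK : (p \mPo ysum) \mPo tau = p.
  rewrite comp_mpoly_comp -[RHS]comp_mpoly_id; congr comp_mpoly.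
  apply: eq_from_tnth => i; rewrite !tnth_mktuple comp_mpoly_sum (bigD1 (jf i)) //=.
  rewrite comp_mpolyXU -tnth_nth tauE eqxx big1 ?addr0 // => j nej.
  by rewrite comp_mpolyXU -tnth_nth tauE eq_sym (negPf nej).
suff coefE q : q@_(block_lift u) = (q \mPo tau)@_u by rewrite coefE pK.
rewrite [q]mpolyE comp_mpoly_sum !raddf_sum /=.
apply: eq_bigr => v _; rewrite comp_mpolyZ !mcoeffZ mcoeffX; congr (_ * _).
rewrite comp_mpolyX big_mxvec_index.
(* Either y^v is itself a lift, and [tau] recovers the lifted monomial, or it contains some y_ji
   with j different from [jf i], and [tau] kills it. *)
have [E|nE] := eqVneq v (block_lift (\sum_(j < r) yblock j v)%MM).
  rewrite (_ : \prod_i _ = 'X_[(\sum_(j < r) yblock j v)%MM]).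
    rewrite mcoeffX {1}E; congr (nat_of_bool _)%:R; apply/eqP/eqP => [E'|-> //].
    by rewrite -[LHS]sum_yblock_lift E' sum_yblock_lift.
  rewrite mpolyXE_id exchange_big; apply: eq_bigr => i _ /=.
  rewrite (bigD1 (jf i)) //= big1 ?mulr1 => [|j nej].
    rewrite tauE eqxx {1}E mnmE mxvec_indexK /= eqxx.
    by rewrite sum_yblockE.
  by rewrite {1}E mnmE mxvec_indexK /= eq_sym (negPf nej) expr0.
have [k kP] : exists k : 'I_(r * n), tnth tau k = 0 /\ v k != 0%N.
  apply: NNPP => no; case/eqP: nE; apply/mnmP => k.
  have vk0 j i : jf i != j -> v (mxvec_index j i) = 0%N.
    move=> nej; apply/eqP/negPn/negP => vk; apply: no.
    by exists (mxvec_index j i); rewrite tauE (negPf nej).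
  case/mxvec_indexP: k => j i; rewrite mnmE mxvec_indexK /= sum_yblockE.
  case: eqP => [<-|/eqP/vk0 -> //]; rewrite (bigD1 (jf i)) //= big1 ?addn0 // => j' nej.
  by rewrite vk0 // eq_sym.
case/mxvec_indexP: k kP => j i [tk vk].
rewrite (bigD1 j) //= (bigD1 i) //= tk expr0n (negPf vk) !mul0r mcoeff0.
case: eqP => // E; case/eqP: nE.
by rewrite E sum_yblock_lift.
Qed.

End Blocks.

(** * Standard monomials of the secant ideal from disjoint faces *)

Section LowerBound.
Variables (K : fieldType) (d n r : nat) (A : 'M[int]_(d, n)) (le : rel 'X_{1..n}).
Hypothesis le_order : term_order le.
Variable Delta : {set {set 'I_n}}.
Hypothesis DeltaP : forall S : {set 'I_n}, S \in Delta <->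
  forall k : nat, ~ initial_ideal le (toric_ideal K A) ((\prod_(i in S) 'X_i) ^+ k).

Let le_refl m : le m m.
Proof. by have [le_total _ _ _ _] := le_order; have := le_total m m; rewrite orbb. Qed.

Lemma term_orderD m1 m2 m3 m4 : le m1 m2 -> le m3 m4 -> le (m1 + m3)%MM (m2 + m4)%MM.
Proof.
have [_ le_trans _ _ leD] := le_order; move=> le12 le34.
apply: (le_trans (m2 + m3)%MM); first exact: leD.
by rewrite !(addmC m2); apply: leD.
Qed.

Lemma term_order_sum I (s : seq I) (P : pred I) (a b : I -> 'X_{1..n}) :
    (forall j, P j -> le (a j) (b j)) ->
  le (\sum_(j <- s | P j) a j)%MM (\sum_(j <- s | P j) b j)%MM.
Proof.
by move=> leab; elim/big_ind2: _ => // *; apply: term_orderD.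
Qed.

(** A strict inequality in one summand would persist in the sum, since exponents can be
    cancelled. *)
Lemma term_order_sum_eq (a b : 'I_r -> 'X_{1..n}) :
    (forall j, le (a j) (b j)) -> (\sum_j a j)%MM = (\sum_j b j)%MM ->
  forall j, a j = b j.
Proof.
have [_ _ le_anti _ leD] := le_order.
move=> leab eqab j; move: eqab; rewrite (bigD1 j) //= [RHS](bigD1 j) //= => eqab.
apply: (@addIm _ (\sum_(i | i != j) b i)%MM); apply: le_anti; rewrite leD //= -eqab.
by apply: term_orderD => //; apply: term_order_sum.
Qed.

Lemma disjoint_faces_not_leading (S : 'I_r -> {set 'I_n}) (jf : 'I_n -> 'I_r)
    (u : 'X_{1..n}) (p : {mpoly K[n]}) :
    (forall j, S j \in Delta) -> (forall i, u i != 0%N -> i \in S (jf i)) ->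
    secant_ideal r (toric_ideal K A) p ->
  ~ leading_monomial le p u.
Proof.
have [le_total _ le_anti _ _] := le_order.
move=> SD uS Ip [up umax].
have := secant_fibre_null Ip (secant_weight A (block_lift jf u)).
rewrite /fibre_sum big_mkcond (bigD1_seq (block_lift jf u)) ?msupp_uniq //=; last first.
  by rewrite mcoeff_msupp mcoeff_block_lift -mcoeff_msupp.
rewrite eqxx mcoeff_block_lift big_seq_cond big1 => [/eqP|v].
  by rewrite addr0 -[_ == _]negbK -mcoeff_msupp up.
move=> /andP[vp /eqP nev]; case: eqP => // wv; case: nev.
(* Otherwise block j of the lift, supported on the face [S j], would lead a toric binomial. *)
have le_block j : le (yblock j (block_lift jf u)) (yblock j v).
  have [//|le_vu] := orP (le_total (yblock j (block_lift jf u)) (yblock j v)).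
  have [->|ne] := eqVneq (yblock j (block_lift jf u)) (yblock j v).
    exact: le_refl.
  have wE : toric_weight A (yblock j (block_lift jf u)) = toric_weight A (yblock j v).
    by have /ffunP/(_ j) := wv; rewrite !ffunE => ->.
  case: (face_not_leading DeltaP (SD j) _ (toric_binomial K wE)
    (binomial_leading _ le_order le_vu ne)).
  by move=> i; rewrite yblock_lift; case: (jf i =P j) => [<-|//]; apply: uS.
(* The right side is an exponent of [p], hence at most the leading [u], which is the left side. *)
have eq_sum : (\sum_j yblock j (block_lift jf u))%MM = (\sum_j yblock j v)%MM.
  apply: le_anti; rewrite term_order_sum //= sum_yblock_lift.
  exact/umax/msupp_comp_ysum.
by apply: yblock_inj => j; rewrite (term_order_sum_eq le_block).
Qed.

End LowerBound.

Lemma weight_bound d n (A : 'M[int]_(d, n)) m k :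
  (absz (toric_weight A m k ord0) <= (\sum_k \sum_i absz (A k i)) * mdeg m)%N.
Proof.
rewrite toric_weightE; apply: (@leq_trans (\sum_i absz (A k i) * mdeg m)%N).
  elim/big_rec2: _ => // i x y _ le_yx.
  have : (absz (A k i *+ m i) <= absz (A k i) * mdeg m)%N.
    by rewrite -mulr_natr natz abszM absz_nat leq_mul2l mdegE (bigD1 i) //= leq_addr orbT.
  by lia.
rewrite -big_distrl leq_mul2r; apply/orP; right.
by rewrite [leqRHS](bigD1 k) //= leq_addr.
Qed.

(** * Upper bound by counting tuples of weights *)

Section UpperBound.
Variables (K : fieldType) (d n r : nat) (A : 'M[int]_(d, n)).
Hypothesis A_graded : exists w : 'cV[rat]_d,
  forall j : 'I_n, (w^T *m col j (map_mx intr A)) 0 0 = 1.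

Lemma hilbert_function_upper_bound : (0 < n)%N -> (0 < r)%N ->
  exists B, forall m h,
    hilbert_function_at (secant_ideal r (toric_ideal K A)) m h ->
    (h <= (B * m + 1) ^ (r * d - 1))%N.
Proof.
move=> n_gt0 r_gt0; have [w wP] := A_graded.
pose j0 := Ordinal r_gt0.
pose B := (\sum_k \sum_i absz (A k i))%N.
have [k0 wk0] : exists k0, w k0 0 != 0.
  apply: NNPP => no; have /eqP := wP (Ordinal n_gt0).
  rewrite mxE big1 1?eq_sym ?oner_eq0 // => k _; rewrite mxE.
  by have [->|wk] := eqVneq (w k 0) 0; [rewrite mul0r | case: no; exists k].
have weight_deg m : \sum_k w k 0 * (toric_weight A m k 0)%:~R = (mdeg m)%:R :> rat.
  rewrite (weight_linear A (fun k => w k 0)) mdegE natr_sum; apply: eq_bigr => i _.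
  rewrite -[RHS]mulr1; congr (_ * _); apply: etrans (wP i).
  by rewrite mxE; apply: eq_bigr => k _; rewrite !mxE.
exists (2 * B)%N => m h [b [homb freeb _]].
(* In degree m all entries weighted by [w] add up to m. As [w k0 0] is nonzero, the entry at (j0,
   k0) is determined by the others and is left out. *)
pose J := {x : 'I_r * 'I_d | x != (j0, k0)}.
pose T := {ffun J -> 'I_(2 * B * m).+1}.
(* In degree m the entries have absolute value at most [B * m], so the shifted ones fit into the
   range of [inord]. *)
pose code (v : 'X_{1..r * n}) : T := [ffun x : J =>
  inord (absz ((secant_weight A v (val x).1) (val x).2 ord0 + (B * m)%:Z)%R)].
have cardT : #|T| = ((2 * B * m + 1) ^ (r * d - 1))%N.
  rewrite card_ffun card_ord addn1 card_sig; congr (_ ^ _)%N.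
  by have := cardC1 (j0, k0); rewrite card_prod !card_ord subn1.
rewrite -cardT leqNgt; apply/negP => ltTh.
pose F i := b i \mPo ysum K n r.
(* With more basis elements than codes, some nontrivial combination has all fibre sums 0. It lies in
   the secant ideal, against independence. *)
have [c c0 cM] :=
  mulmx_kernel_neq0 (\matrix_(i, x) fibre_sum code (enum_val x) (F i)) ltTh.
case/negP: c0; apply/eqP/rowP => i; rewrite mxE; apply: freeb.
apply: (@secant_of_fibre_null _ _ _ _ A _ code); last first.
  move=> t; have /rowP/(_ (enum_rank t)) := cM; rewrite !mxE => {1}<-.
  rewrite comp_mpoly_sum raddf_sum /=; apply: eq_bigr => i' _.
  by rewrite comp_mpolyZ linearZ /= mxE enum_rankK.
have homp : \sum_i c 0 i *: b i \is m.-homog by apply: rpred_sum => i' _; apply: dhomogZ.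
move=> v1 v2 /(comp_ysum_homog homp) deg1 /(comp_ysum_homog homp) deg2 eqc.
have small (v : 'X_{1..r * n}) j k : mdeg v = m ->
    (absz (secant_weight A v j k ord0) <= B * m)%N.
  move=> <-; rewrite ffunE; apply: leq_trans (weight_bound _ _ _) _.
  by rewrite leq_mul2l mdeg_yblock (bigD1 j) //= leq_addr orbT.
have eqjk j k : (j, k) != (j0, k0) ->
    secant_weight A v1 j k ord0 = secant_weight A v2 j k ord0.
  move=> ne; have /ffunP/(_ (Sub (j, k) ne : J)) := eqc; rewrite !ffunE !SubK /=.
  have := small v1 j k deg1; have := small v2 j k deg2; rewrite !ffunE.
  move: (toric_weight _ _ _ _) (toric_weight _ _ _ _) => x y lex ley.
  by move/(congr1 val); rewrite /= !inordK; lia.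
have sumE (v : 'X_{1..r * n}) :
    \sum_j \sum_k w k 0 * (secant_weight A v j k 0)%:~R = (mdeg v)%:R.
  by rewrite mdeg_yblock natr_sum; apply: eq_bigr => j _; rewrite ffunE weight_deg.
have eq0 : secant_weight A v1 j0 k0 ord0 = secant_weight A v2 j0 k0 ord0.
  apply/eqP; rewrite -(eqr_int rat); apply/eqP/(mulfI wk0).
  have := sumE v1; rewrite deg1 -deg2 -sumE !pair_bigA /=.
  rewrite (bigD1 (j0, k0)) //= [RHS](bigD1 (j0, k0)) //=.
  rewrite (eq_bigr (fun p => w p.2 0 * (secant_weight A v2 p.1 p.2 0)%:~R)).
    exact: addIr.
  by move=> [j k] ne; rewrite /= eqjk.
apply/ffunP => j; apply/colP => k.
have [[-> ->]|/eqP ne] := (j, k) =P (j0, k0); [exact: eq0 | exact: eqjk].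
Qed.

End UpperBound.

(** * From partitionable sets to dimension and degree *)

Lemma r_partitionable_card (n d r : nat) (Delta : {set {set 'I_n}}) (C : {set 'I_n}) :
    (forall S, S \in facets Delta -> #|S| = d) -> r_partitionable Delta r C ->
  #|C| = (r * d)%N.
Proof.
move=> cardS /existsP[P /and3P[/subsetP PD /eqP cardP partP]].
by rewrite (card_uniform_partition (n := d) _ partP) ?cardP // => S /PD/cardS.
Qed.

Lemma r_partitionable_standard (K : fieldType) (d n r : nat) (A : 'M[int]_(d, n))
    (le : rel 'X_{1..n}) (Delta : {set {set 'I_n}}) (C : {set 'I_n}) (u : 'X_{1..n}) :
    term_order le ->
    (forall S : {set 'I_n}, S \in Delta <->
      forall k : nat, ~ initial_ideal le (toric_ideal K A) ((\prod_(i in S) 'X_i) ^+ k)) ->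
    (0 < r)%N -> r_partitionable Delta r C -> (forall i, u i != 0%N -> i \in C) ->
  ~ nonstandard le (secant_ideal r (toric_ideal K A)) u.
Proof.
move=> le_order DeltaP r_gt0 /existsP[P /and3P[/subsetP PD /eqP cardP partP]] uC.
move=> [p [Ip _]]; have [/eqP coverP _ _] := and3P partP.
have szP : size (enum P) = r by rewrite -cardE.
pose S (j : 'I_r) := nth set0 (enum P) j.
(* The default index is taken only off [C], where [u] vanishes. *)
pose jf i : 'I_r := insubd (Ordinal r_gt0) (index (pblock P i) (enum P)).
apply: (disjoint_faces_not_leading le_order DeltaP (S := S) (jf := jf)) Ip.
  move=> j; have : S j \in P by rewrite -mem_enum mem_nth ?szP.
  by move/PD; rewrite inE => /maxsetp.
move=> i /uC; rewrite -coverP => iC; have iP := pblock_mem iC.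
have ltr : (index (pblock P i) (enum P) < r)%N by rewrite -[ltnRHS]szP index_mem mem_enum.
rewrite /S /jf val_insubd ltr nth_index ?mem_enum //.
by rewrite mem_pblock.
Qed.

(** Each partitionable [C] contributes the vectors with support exactly [C], all of them standard.
    Exact supports keep the contributions of different sets disjoint. *)
Lemma hilbert_function_lower_bound (K : fieldType) (d n r c : nat) (A : 'M[int]_(d, n))
    (le : rel 'X_{1..n}) (Delta : {set {set 'I_n}}) m :
    term_order le ->
    (forall S : {set 'I_n}, S \in Delta <->
      forall k : nat, ~ initial_ideal le (toric_ideal K A) ((\prod_(i in S) 'X_i) ^+ k)) ->
    (0 < r)%N -> (forall C, r_partitionable Delta r C -> #|C| = c) ->
    (0 < c)%N -> (0 < m)%N ->
  (#|[set C | r_partitionable Delta r C]| * 'C(m.-1, c.-1) <=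
   count (predC (nonstandardb le (secant_ideal r (toric_ideal K A)))) (compositions n m))%N.
Proof.
move=> le_order DeltaP r_gt0 cardC c_gt0 m_gt0.
pose mask (C : {set 'I_n}) : bitseq := [seq i \in C | i <- enum 'I_n].
have sz_mask C : size (mask C) = n by rewrite size_map size_enum_ord.
have count_mask C : count id (mask C) = #|C|.
  by rewrite /mask count_map cardE enumT -size_filter.
have nth_mask C (i : 'I_n) : nth false (mask C) i = (i \in C).
  by rewrite (nth_map i) ?size_enum_ord // nth_ord_enum.
have mask_inj : injective mask.
  by move=> C1 C2 E; apply/setP => i; rewrite -!nth_mask E.
rewrite -sum_nat_const.
rewrite (eq_bigr (fun C =>
  \sum_(s <- compositions n m) ([seq 0 < x | x <- s]%N == mask C))%N).
  rewrite exchange_big -sum1_count [leqRHS]big_mkcond /=.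
  rewrite big_seq [leqRHS]big_seq; apply: leq_sum => s sm.
  have [|/existsPn noC] := boolP [exists C,
      r_partitionable Delta r C && ([seq 0 < x | x <- s]%N == mask C)].
    move=> /existsP[C /andP[CP /eqP sC]].
    rewrite (bigD1 C) ?inE //= sC eqxx big1 ?addn0 => [|C' /andP[_ neC]].
      rewrite ifT //; apply/nonstandardP.
      apply: (r_partitionable_standard le_order DeltaP r_gt0 CP) => i.
      rewrite mnmE -nth_mask -sC => ui; rewrite (nth_map 0%N) ?lt0n //.
      by move: sm; rewrite mem_compositions => /andP[/eqP-> _].
    by rewrite (inj_eq mask_inj) eq_sym (negPf neC).
  rewrite big1 // => C; rewrite inE => CP; have := noC C.
  by rewrite CP andTb => /negPf->.
move=> C; rewrite inE => /cardC Cc.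
rewrite -[in RHS](sz_mask C) -Cc -count_mask -count_exact_support ?count_mask ?Cc //.
by rewrite -sum1_count big_mkcond; apply: eq_bigr => s _; case: ifP.
Qed.

Theorem theorem5p4 (K : fieldType) (d n r : nat) (A : 'M[int]_(d, n))
    (Delta : {set {set 'I_n}})
    (n_gt0 : (0 < n)%N)
    (A_distinct : injective (fun j : 'I_n => col j A))
    (A_rank : \rank (map_mx intr A : 'M[rat]_(d, n)) = d)
    (A_graded : exists w : 'cV[rat]_d,
       forall j : 'I_n, (w^T *m col j (map_mx intr A)) 0 0 = 1)
    (r_gt0 : (0 < r)%N)
    (Delta_regular : regular_triangulation K A Delta)
    (Delta_full : full_complex Delta)
    (Delta_partitionable : exists C : {set 'I_n}, r_partitionable Delta r C) :
  proj_dimension (secant_ideal r (toric_ideal K A))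
    (minn (r * d - 1) (n - 1)) /\
  exists2 e : rat,
    proj_degree (secant_ideal r (toric_ideal K A)) e &
    #|[set C : {set 'I_n} | r_partitionable Delta r C]|%:R <= e.
Proof.
have [le le_order DeltaP] := Delta_regular; have [C0 C0P] := Delta_partitionable.
have card_part C : r_partitionable Delta r C -> #|C| = (r * d)%N.
  by apply: r_partitionable_card => S; apply: (card_facet le_order DeltaP A_graded A_rank).
(* For d = 0 the grading would equate an empty sum with 1. *)
have d_gt0 : (0 < d)%N.
  case: posnP => // d0; have [w /(_ (Ordinal n_gt0)) /eqP] := A_graded.
  rewrite mxE big1 1?eq_sym ?oner_eq0 // => k.
  by have := leq_trans (ltn_ord k) (eq_leq d0).
have rd_gt0 : (0 < r * d)%N by rewrite muln_gt0 r_gt0.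
(* A partitionable set fits into the n points, so the minimum in the statement is [r * d - 1]. *)
have le_rd_n : (r * d <= n)%N.
  by rewrite -(card_part C0) // -[leqRHS]card_ord max_card.
pose J := secant_ideal r (toric_ideal K A).
have JD p q : J p -> J q -> J (p + q).
  by rewrite /J /secant_ideal comp_mpolyD; apply: ideal_genD.
have JM p q : J q -> J (p * q).
  by rewrite /J /secant_ideal comp_mpolyM; apply: ideal_genM.
have J0 : J 0 by rewrite /J /secant_ideal comp_mpoly0; apply: ideal_gen0.
have JH := standard_hilbert_function le_order J0 JD JM.
have [P [M PM]] := upset_hilbert_polynomial n (nonstandardb_upset le_order JM).
have hilbP : hilbert_polynomial J P.
  exists M => m leMm.
  by exists (count (predC (nonstandardb le J)) (compositions n m)); rewrite ?PM.
have [B upB] := hilbert_function_upper_bound K A_graded n_gt0 r_gt0.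
pose N := #|[set C : {set 'I_n} | r_partitionable Delta r C]|.
have N_gt0 : (0 < N)%N by apply/card_gt0P; exists C0; rewrite inE.
(* The bound [maxn M 1] excludes degree 0, where the count of exact supports does not apply. *)
have [||szP lcP] := @growth_lead_coef P N (r * d - 1) 1 B (maxn M 1) N_gt0.
- move=> m; rewrite geq_max => /andP[leM m_gt0]; rewrite PM // ler_nat subn1.
  exact: (hilbert_function_lower_bound le_order DeltaP).
- by move=> m; rewrite geq_max => /andP[leM _]; rewrite PM // ler_nat; apply: upB.
split; first by exists P => //; rewrite szP; congr _.+1; apply/esym/minn_idPl; lia.
exists (lead_coef P * (r * d - 1)`!%:R) => //.
by exists P => //; exists (r * d - 1)%N.
Qed.
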